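(* Let $(\Omega,\mathcal G,\mathbb P)$ be a probability space, $\mathcal F=(\mathcal F_t)_{t\in[0,\infty)}$ a filtration with $\mathcal F_\infty\subset\mathcal G$, and $X$ an $\mathbb R^d$-valued Lévy process relative to $\mathcal F$ with law $\mathcal L$ on $(\mathbb D,\mathcal D)$. For $x\in\mathbb R^d$ let $\mathbb P^x$ be the law of $x+X$ under $\mathbb P$, $\mathcal P:=(\mathbb P^x)_{x\in\mathbb R^d}$. Let $R:\Omega\to[0,\infty]$ be $\mathcal G$-measurable with $\mathbb P(R<\infty)>0$ and $\mathbb P'(\cdot):=\mathbb P(\cdot\mid R<\infty)$. Consider: (i) under $\mathbb P'$, conditionally on $X_R$, $\theta_RX$ is independent of $\mathcal F_R'$ and has kernel law $\mathcal P$, i.e. $\mathbb E_{\mathbb P'}[H(\theta_RX)W]=\mathbb E_{\mathbb P'}[\mathbb P^{X_R}(H)W]$ for all $\mathcal D$-measurable $H:\mathbb D\to[0,\infty]$ and all $\mathcal F_R'$-measurable $W:\{R<\infty\}\to[0,\infty]$; (ii) $\Delta_RX$ is independent of $\mathcal F_R'$ under $\mathbb P'$ and the law of $\Delta_RX$ under $\mathbb P'$ is $\mathcal L$; (iii) $R$ is a stopping time relative to the completion of $\mathcal F$. Then (iii) implies (ii), and (i) and (ii) are equivalent. If in addition $R$ is $\overline{\sigma(X)}$-measurable, then (ii) implies (iii).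
   Context: $X$ is a Lévy process relative to $\mathcal F$: $\mathcal F$-adapted, càdlàg, $X_0=0$ a.s., and $X_t-X_s$ independent of $\mathcal F_s$ with the law of $X_{t-s}$ for $s\le t$. $(\mathbb D,\mathcal D)$: càdlàg paths $[0,\infty)\to\mathbb R^d$ with the coordinate $\sigma$-field. On $\{R<\infty\}$, $\theta_RX:=(X_{R+t})_{t\ge0}$ and $\Delta_RX:=(X_{R+t}-X_R)_{t\ge0}$. $\mathcal F_R'$ is the $\sigma$-field on $\{R<\infty\}$ generated by $Z_R$ as $Z$ ranges over real processes measurable w.r.t. the optional $\sigma$-field of $\mathcal F$ (generated by $\mathcal F$-adapted càdlàg real processes). $\overline{\mathcal H}$ denotes the $\sigma$-field generated by $\mathcal H$ and the $\mathbb P$-null sets of $\mathcal G$; the completion of a filtration is obtained by completing each member. *)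

(* Defs.v *)
From HB Require Import structures.
From mathcomp Require Import all_boot all_order all_algebra.
From mathcomp Require Import all_classical all_reals all_analysis.
From mathcomp Require Import measurable_realfun.
Set Implicit Arguments. Unset Strict Implicit. Unset Printing Implicit Defensive.
Import Order.TTheory GRing.Theory Num.Theory.
Import numFieldNormedType.Exports.
Local Open Scope classical_set_scope.
Local Open Scope ring_scope.

(* R^n is represented by row vectors 'rV[R]_n.
   Time is R, but only times t >= 0 are ever used: paths are [0,oo) -> R^n
   and every notion below only depends on the values at t >= 0. *)

Section Paths.
Variables (R : realType) (n : nat).
Local Notation V := 'rV[R]_n.

Definition borelRn : set (set V) :=
  <<s [set A | exists (i : 'I_n) (B : set R),
                 measurable B /\ A = [set v : V | B (v ord0 i)]] >>.

Definition cadlagR (f : R -> R) : Prop :=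
  (forall t, 0 <= t -> f x @[x --> t^'+] --> f t) /\
  (forall t, 0 < t -> cvg (f x @[x --> t^'-])).

Definition cadlag (f : R -> V) : Prop :=
  forall i : 'I_n, cadlagR (fun t => f t ord0 i).

Definition Dpaths : set (R -> V) := [set f | cadlag f].
Definition Dsigma : set (set (R -> V)) :=
  <<s Dpaths, [set A | exists (t : R) (i : 'I_n) (B : set R),
       0 <= t /\ measurable B /\ A = Dpaths `&` [set f | B (f t ord0 i)]] >>.

(* H : \mathbb D -> [0, oo] is \mathcal D-measurable (values of H off
   Dpaths are irrelevant) *)
Definition Dmeas_nonneg (H : (R -> V) -> \bar R) : Prop :=
  (forall f, Dpaths f -> (0 <= H f)%E) /\
  (forall B : set (\bar R), measurable B -> Dsigma (Dpaths `&` H @^-1` B)).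
End Paths.

Section Processes.
Variables (R : realType) (d : measure_display) (Omega : measurableType d)
  (P : probability Omega R) (n : nat).
Local Notation V := 'rV[R]_n.

Definition filtration (F : R -> set (set Omega)) : Prop :=
  (forall t, 0 <= t -> sigma_algebra setT (F t)) /\
  (forall s t, 0 <= s -> s <= t -> F s `<=` F t) /\
  (forall t, 0 <= t -> F t `<=` measurable).

Definition Pnull : set (set Omega) := [set N | measurable N /\ P N = 0%E].
Definition completion (S : set (set Omega)) : set (set Omega) :=
  <<s S `|` Pnull >>.
Definition completed_filtration (F : R -> set (set Omega)) : R -> set (set Omega) :=
  fun t => completion (F t).

Definition adapted_cadlag_real (F : R -> set (set Omega)) (Y : R -> Omega -> R) :=
  (forall t, 0 <= t -> forall B : set R, measurable B -> F t (Y t @^-1` B)) /\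
  (forall w, cadlagR (fun t => Y t w)).

Definition optional_sigma (F : R -> set (set Omega)) : set (set (R * Omega)) :=
  <<s [set p | 0 <= p.1],
      [set A | exists (Y : R -> Omega -> R) (B : set R),
         adapted_cadlag_real F Y /\ measurable B /\
         A = [set p | 0 <= p.1 /\ B (Y p.1 p.2)]] >>.

Definition optional_process (F : R -> set (set Omega)) (Z : R -> Omega -> R) :=
  forall B : set R, measurable B ->
    optional_sigma F [set p | 0 <= p.1 /\ B (Z p.1 p.2)].

Definition Tfin (T : Omega -> \bar R) : set Omega := [set w | (T w < +oo)%E].

Definition FT' (F : R -> set (set Omega)) (T : Omega -> \bar R) : set (set Omega) :=
  <<s Tfin T, [set A | exists (Z : R -> Omega -> R) (B : set R),
         optional_process F Z /\ measurable B /\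
         A = Tfin T `&` [set w | B (Z (fine (T w)) w)]] >>.

Definition FT'_meas_nonneg (F : R -> set (set Omega)) (T : Omega -> \bar R)
  (W : Omega -> \bar R) : Prop :=
  (forall w, Tfin T w -> (0 <= W w)%E) /\
  (forall B : set (\bar R), measurable B -> FT' F T (Tfin T `&` W @^-1` B)).

Definition levy (F : R -> set (set Omega)) (X : R -> Omega -> V) : Prop :=
  (forall t, 0 <= t -> forall B, borelRn B -> F t (X t @^-1` B)) /\
  (forall w, cadlag (fun t => X t w)) /\
  {ae P, forall w, X 0 w = 0} /\
  (forall s t, 0 <= s -> s <= t -> forall B A, borelRn B -> F s A ->
     P ([set w | B (X t w - X s w)] `&` A) =
     (P [set w | B (X (t - s)%R w)] * P A)%E).

Definition path (X : R -> Omega -> V) (w : Omega) : R -> V := fun t => X t w.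

Definition law (X : R -> Omega -> V) (A : set (R -> V)) : \bar R :=
  P [set w | A (path X w)].

Definition Pker (X : R -> Omega -> V) (x : V) (H : (R -> V) -> \bar R) : \bar R :=
  (\int[P]_w H (fun t => (x + X t w)%R))%E.

Definition X_at (X : R -> Omega -> V) (T : Omega -> \bar R) (w : Omega) : V :=
  X (fine (T w)) w.
Definition theta (X : R -> Omega -> V) (T : Omega -> \bar R) (w : Omega) : R -> V :=
  fun t => X (fine (T w) + t) w.
Definition Delta (X : R -> Omega -> V) (T : Omega -> \bar R) (w : Omega) : R -> V :=
  fun t => X (fine (T w) + t) w - X (fine (T w)) w.

Definition condP (A B : set Omega) : \bar R :=
  (P (A `&` B) * ((fine (P A))^-1)%:E)%E.
Definition condE (A : set Omega) (f : Omega -> \bar R) : \bar R :=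
  ((\int[P]_(w in A) f w) * ((fine (P A))^-1)%:E)%E.

Definition stopping_time (G : R -> set (set Omega)) (T : Omega -> \bar R) : Prop :=
  forall t, 0 <= t -> G t [set w | (T w <= t%:E)%E].

Definition sigmaX (X : R -> Omega -> V) : set (set Omega) :=
  <<s [set A | exists (t : R) (i : 'I_n) (B : set R), 0 <= t /\
         measurable B /\ A = [set w | B (X t w ord0 i)]] >>.

Definition prop_i (F : R -> set (set Omega)) (X : R -> Omega -> V)
  (T : Omega -> \bar R) : Prop :=
  forall (H : (R -> V) -> \bar R) (W : Omega -> \bar R),
    Dmeas_nonneg H -> FT'_meas_nonneg F T W ->
    condE (Tfin T) (fun w => H (theta X T w) * W w)%E =
    condE (Tfin T) (fun w => Pker X (X_at X T w) H * W w)%E.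
Definition prop_ii (F : R -> set (set Omega)) (X : R -> Omega -> V)
  (T : Omega -> \bar R) : Prop :=
  (forall A G, Dsigma A -> FT' F T G ->
     condP (Tfin T) ([set w | A (Delta X T w)] `&` G) =
     (condP (Tfin T) [set w | A (Delta X T w)] * condP (Tfin T) G)%E) /\
  (forall A, Dsigma A -> condP (Tfin T) [set w | A (Delta X T w)] = law X A).
Definition prop_iii (F : R -> set (set Omega)) (T : Omega -> \bar R) : Prop :=
  stopping_time (completed_filtration F) T.
End Processes.

(* Main.v *)
(** Write L for the law of X on the path space. With X^R the path stopped at R
    and X_R, both F'_R-measurable, one has theta_R X = X_R + Delta_R X, so (ii)
    gives (i) by Fubini; conversely (i) is applied to functionals of
    f - f(0).

    (iii) => (ii): approximate R from above by R_k = (floor(kR) + 1)/k, use the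
    Markov property at each value of R_k, and let k go to infinity by right
    continuity.

    (ii) => (iii): fix t. On {R <= t} the path stopped at t and the increments
    Delta_t X are functions of (R, X^R) and Delta_R X. Freezing (R, X^R) and
    applying the Markov property at the deterministic time t - R shows that, on
    {R <= t}, Delta_t X is still independent of X^t with law L. Now {R <= t}
    is a.s. an event {X in C}, and X is a function of X^t and Delta_t X.
    Freezing X^t, the conditional probability p = P(X in C | X^t) satisfies
    E[p; R <= t] = P(R <= t) = E[p]; hence p = 1 a.s. on {R <= t} and p = 0
    a.s. off it, that is, {R <= t} = {p = 1} a.s. *)

Require Import Defs.
From HB Require Import structures.
From mathcomp Require Import all_boot all_order all_algebra.
From mathcomp Require Import all_classical all_reals all_analysis.
From mathcomp Require Import measurable_realfun.
Import Order.TTheory GRing.Theory Num.Theory.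
Import numFieldNormedType.Exports.
Local Open Scope classical_set_scope.
Local Open Scope ring_scope.

Set Implicit Arguments. Unset Strict Implicit. Unset Printing Implicit Defensive.

(** * Convergence, cadlag functions, random times, freezing *)

(** Independence is postulated for one increment and one past event, while (i) and (ii) concern
    whole future paths. The gap is closed once, at deterministic times, in [levy_indep]; every later
    use of the Markov property rests on it.

    Freezing is done with the sample point itself as frozen variable, on a copy of [Omega] that
    carries the sigma-field at [T]. Then [T], the stopped path and any admissible weight [W] become
    parameters at the same time, and independence has to be known on rectangles only.

    In (ii) => (iii) the event {T <= t} is not known to lie in the completed F_t, so the Markov
    property at t cannot be applied on it; the required independence has to come out of (ii).
    Measurability of [T] with respect to the path is essential afterwards: if F is generated by X, a
    random time independent of X whose law is not a point mass satisfies (ii) without being a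
    stopping time. *)

Section CvgMinMax.
Context {R : realType} {T : Type} {F : set_system T} {FF : Filter F}.
Implicit Types (f g : T -> R).

Lemma cvg_minr f g (a b : R) : f @ F --> a -> g @ F --> b ->
  Num.min (f x) (g x) @[x --> F] --> Num.min a b.
Proof.
move=> fa gb; rewrite minr_absE; under eq_fun do rewrite minr_absE.
by apply: cvgMl; apply: cvgB; [exact: cvgD|apply: cvg_norm; exact: cvgB].
Qed.

Lemma cvg_maxr f g (a b : R) : f @ F --> a -> g @ F --> b ->
  Num.max (f x) (g x) @[x --> F] --> Num.max a b.
Proof.
move=> fa gb; rewrite maxr_absE; under eq_fun do rewrite maxr_absE.
by apply: cvgMl; apply: cvgD; [exact: cvgD|apply: cvg_norm; exact: cvgB].
Qed.

End CvgMinMax.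

Section CadlagComp.
Context {R : realType}.
Implicit Types (f phi : R -> R).

(** A nondecreasing time change sends a one-sided neighbourhood of t either strictly to the same
    side of [phi t] or, where [phi] is flat, onto [phi t] itself; hence the case distinction on the
    left. It covers shifting, stopping and delaying a path. *)
Lemma cadlagR_comp f phi :
  cadlagR f -> (forall t, 0 <= t -> 0 <= phi t) ->
  {homo phi : x y / x <= y} -> continuous phi -> cadlagR (f \o phi).
Proof.
move=> [fr fl] phi0 phim phic; split => [t t0|t t0].
- apply/cvgrPdist_le => e e0 /=.
  have /cvgrPdist_le/(_ e e0) := fr _ (phi0 _ t0).
  rewrite {1}/at_right near_withinE => H.
  have H' := phic t _ H.
  near=> s.
  have ts : t <= s by near: s; exact: nbhs_right_ge.
  have := phim _ _ ts; rewrite le_eqVlt => /predU1P[<-|h].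
    by rewrite subrr normr0 ltW.
  have : phi t < phi s -> `|f (phi t) - f (phi s)| <= e.
    by near: s; apply: cvg_within.
  exact.
- have [[s [st ps]]|H] := pselect (exists s, s < t /\ phi s = phi t).
    apply/cvg_ex; exists (f (phi t)).
    apply/cvgrPdist_le => e e0 /=; near=> u.
    have -> : phi u = phi t.
      apply/eqP; rewrite eq_le; apply/andP; split.
        by apply: phim; near: u; exact: nbhs_left_le.
      by rewrite -ps; apply: phim; near: u; exact: nbhs_left_ge.
    by rewrite subrr normr0 ltW.
  have lt s : s < t -> phi s < phi t.
    move=> st; rewrite lt_neqAle phim ?ltW// andbT; apply/eqP => ps.
    by apply: H; exists s.
  have pt : 0 < phi t by apply: le_lt_trans (lt _ t0); exact: phi0.
  have /cvg_ex[l /= fl'] := fl _ pt.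
  apply/cvg_ex; exists l.
  apply/cvgrPdist_le => e e0 /=.
  have /cvgrPdist_le/(_ e e0) := fl'.
  rewrite {1}/at_left near_withinE => K.
  have K' := phic t _ K.
  near=> s.
  have : phi s < phi t -> `|l - f (phi s)| <= e.
    by near: s; apply: cvg_within.
  apply; apply: lt; near: s; exact: nbhs_left_lt.
Unshelve. all: by end_near. Qed.

Lemma cadlagR_cst (c : R) : cadlagR (fun=> c).
Proof. by split => t _; [exact: cvg_cst|exact: is_cvg_cst]. Qed.

Lemma cadlagRD f g : cadlagR f -> cadlagR g -> cadlagR (fun t => f t + g t).
Proof.
move=> [f1 f2] [g1 g2]; split => t t0.
  by apply: cvgD; [exact: f1|exact: g1].
by apply: is_cvgD; [exact: f2|exact: g2].
Qed.

Lemma cadlagR_id : cadlagR (fun t : R => t).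
Proof.
split => t _; first by apply: cvg_at_right_filter; exact: cvg_id.
by apply/cvg_ex; exists t; apply: cvg_at_left_filter; exact: cvg_id.
Qed.

End CadlagComp.

Section RandomTime.
Context {R : realType}.

(** The next point after r on the grid of mesh 1/(k+1), strictly larger than r even if r lies on the
    grid: the right limits in [cadlagR] are taken along points strictly above. *)
Definition gridup (k : nat) (r : R) : R :=
  (Num.truncn (k.+1%:R * r)).+1%:R / k.+1%:R.

Lemma gridup_gt k r : r < gridup k r.
Proof. by rewrite ltr_pdivlMr// mulrC truncnS_gt. Qed.

Lemma gridup_le k r : 0 <= r -> gridup k r <= r + k.+1%:R^-1.
Proof.
move=> r0; rewrite ler_pdivrMr// mulrDl mulVf// mulrC -natr1 lerD2r.
by rewrite truncn_le mulr_ge0.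
Qed.

Lemma gridup_cvg r : 0 <= r -> gridup ^~ r @ \oo --> r.
Proof.
move=> r0; apply: (@squeeze_cvgr _ _ _ _ (fun=> r) (fun k => r + k.+1%:R^-1)).
- by near=> k; rewrite ltW ?gridup_gt//= gridup_le.
- exact: cvg_cst.
- rewrite -[X in _ --> X]addr0; apply: cvgD; first exact: cvg_cst.
  exact: cvg_harmonic.
Unshelve. all: by end_near. Qed.

Lemma cvg_gridup (f : R -> R) r s : 0 <= r ->
  cadlagR f -> 0 <= s -> f (gridup k r + s) @[k --> \oo] --> f (r + s).
Proof.
move=> r0 [fr _] s0.
have /cvg_at_rightP := fr (r + s) (addr_ge0 r0 s0); apply; split.
  by move=> k; rewrite ltrD2r gridup_gt.
by apply: cvgD; [exact: gridup_cvg|exact: cvg_cst].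
Qed.

(** On each of the countably many level sets of [gridup k (tau w)] the process is read at a fixed
    time; right continuity then carries measurability to the limit. *)
Lemma measurable_random_time d (T : measurableType d) (Y : R -> T -> R)
    (tau : T -> R) :
  (forall t, 0 <= t -> measurable_fun setT (Y t)) ->
  (forall w, cadlagR (Y ^~ w)) ->
  measurable_fun setT tau -> (forall w, 0 <= tau w) ->
  measurable_fun setT (fun w => Y (tau w) w).
Proof.
move=> mY Yc mt t0.
apply: (@measurable_fun_cvg _ _ _ _ (fun k w => Y (gridup k (tau w)) w)); last first.
  by move=> w _; have := @cvg_gridup (Y ^~ w) _ 0 (t0 w) (Yc w) (lexx _);
     under eq_fun do rewrite addr0; rewrite addr0.
move=> k _ B mB; rewrite setTI.
rewrite [X in measurable X](_ : _ = \bigcup_j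
   (tau @^-1` [set r | Num.truncn (k.+1%:R * r) == j] `&`
    Y (j.+1%:R / k.+1%:R) @^-1` B)).
  apply: bigcupT_measurable => j; apply: measurableI; last first.
    by rewrite -[X in measurable X]setTI; apply: mY.
  rewrite (_ : _ @^-1` _ = tau @^-1` [set` `[j%:R / k.+1%:R, j.+1%:R / k.+1%:R[ ]).
    by rewrite -[X in measurable X]setTI; exact: mt.
  apply/seteqP; split => w /=; rewrite in_itv /= truncn_eq ?mulr_ge0//;
  by rewrite ler_pdivrMr// ltr_pdivlMr// mulrC.
apply/seteqP; split => [w /= h|w [j _ [/= /eqP <-]]//].
by exists (Num.truncn (k.+1%:R * tau w)) => //; split => /=.
Qed.

End RandomTime.

Section ImageMeasure.
Context d1 d2 (T1 : measurableType d1) (T2 : measurableType d2) {R : realType}.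

Definition image_measure (mu : set T1 -> \bar R) (f : T1 -> T2)
  of measurable_fun setT f := pushforward mu f.

Context (mu : {finite_measure set T1 -> \bar R}) (f : T1 -> T2)
  (mf : measurable_fun setT f).

Let pushm : {measure set T2 -> \bar R} :=
  measure_function_pushforward__canonical__measure_function_Measure mu mf.

HB.instance Definition _ := isMeasure.Build _ _ _ (image_measure mu mf)
  (measure0 pushm) (measure_ge0 pushm) (@measure_semi_sigma_additive _ _ _ pushm).

Let image_measure_fin : fin_num_fun (image_measure mu mf).
Proof.
move=> A mA; apply: fin_num_measure.
by rewrite -[X in measurable X]setTI; exact: mf.
Qed.

HB.instance Definition _ :=
  @Measure_isFinite.Build _ _ _ (image_measure mu mf) image_measure_fin.

End ImageMeasure.

Section ImageProbability.
Context d1 d2 (T1 : measurableType d1) (T2 : measurableType d2) {R : realType}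
  (P : probability T1 R) (f : T1 -> T2) (mf : measurable_fun setT f).

Let image_measure_setT : image_measure P mf setT = 1%E.
Proof. by rewrite /image_measure /pushforward preimage_setT probability_setT. Qed.

HB.instance Definition _ :=
  Measure_isProbability.Build _ _ _ (image_measure P mf) image_measure_setT.

End ImageProbability.

Section Freezing.
Local Open Scope ereal_scope.
Context {R : realType} d (T : measurableType d).

Lemma ge0_integral_mrestr (mu : {measure set T -> \bar R}) (D : set T)
    (mD : measurable D) (f : T -> \bar R) :
  measurable_fun setT f -> (forall x, 0 <= f x) ->
  \int[mu]_(x in D) f x = \int[mrestr mu mD]_x f x.
Proof.
move=> mf f0; have mCD := measurableC mD.
rewrite -[in RHS](setUv D) ge0_integral_setU//=; last 2 first.
- by rewrite setUv.
- by apply/disj_setPLR; rewrite setCK.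
rewrite (@ge0_negligible_integral _ _ _ _ (~` D) (~` D))//; last 2 first.
- exact: measurable_funTS.
- by rewrite /= /mrestr setICl measure0.
rewrite setDv integral_set0 adde0; apply: eq_measure_integral => A mA AD.
by rewrite /= /mrestr setIidl.
Qed.

(* A variable [b] that is independent of [a] is integrated out with [a]
   frozen: both sides integrate [h] against the joint law of [(a, b)]. *)
Lemma freezing d1 d2 (T1 : measurableType d1) (T2 : measurableType d2)
  (mu : {finite_measure set T -> \bar R}) (D : set T) (L : probability T2 R)
  (a : T -> T1) (b : T -> T2) (h : T1 -> T2 -> \bar R) :
  measurable D -> measurable_fun setT a -> measurable_fun setT b ->
  (forall A B, measurable A -> measurable B ->
    mu (D `&` a @^-1` A `&` b @^-1` B) = mu (D `&` a @^-1` A) * L B) ->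
  measurable_fun setT (fun z => h z.1 z.2) -> (forall x y, 0 <= h x y) ->
  \int[mu]_(w in D) h (a w) (b w) = \int[mu]_(w in D) \int[L]_y h (a w) y.
Proof.
move=> mD ma mb ind mh h0.
have mab : measurable_fun setT (fun w => (a w, b w)) by exact: measurable_fun_pair.
have mF := @measurable_fun_fubini_tonelli_F _ _ _ _ _ L _ mh (fun z => h0 z.1 z.2).
rewrite (ge0_integral_mrestr _ mD)//; last exact: (measurableT_comp mh mab).
rewrite (ge0_integral_mrestr _ mD)//; last 2 first.
- exact: (measurableT_comp mF ma).
- by move=> x; apply: integral_ge0.
pose nu : {finite_measure set T -> \bar R} := mrestr mu mD.
have := @ge0_integral_pushforward _ _ _ _ _ _ mab nu setT _ measurableT mh
  (fun z _ => h0 z.1 z.2).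
rewrite preimage_setT /comp /= => <-.
have := @ge0_integral_pushforward _ _ _ _ _ _ ma nu setT _ measurableT mF
  (fun z _ => integral_ge0 _ (fun y _ => h0 z y)).
rewrite preimage_setT /comp /= /fubini_F /= => <-.
have /= <- := @fubini_tonelli1 _ _ _ _ _ (image_measure nu ma) L _ mh
  (fun z => h0 z.1 z.2).
apply: eq_measure_integral => /= A mA _.
(* The joint law of (a, b) on [D] and the product measure agree on rectangles, which is what the
   independence hypothesis provides. *)
apply/esym; apply: (@product_measure_unique _ _ _ _ _ (image_measure nu ma) L
  (image_measure nu mab)) => //= B C mB mC.
rewrite /image_measure /pushforward /= /mrestr.
rewrite -[a @^-1` B `&` D]setIC -ind//; congr (mu _).
by apply/seteqP; split => x /=; tauto.
Qed.

End Freezing.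

(** * The space of cadlag paths *)

Section Cadlag.
Context {R : realType} {n : nat}.
Implicit Types (f g : R -> 'rV[R]_n).

Lemma cadlag_cst (x : 'rV[R]_n) : cadlag (fun=> x).
Proof. by move=> i; exact: cadlagR_cst. Qed.

Lemma cadlagD f g : cadlag f -> cadlag g -> cadlag (fun t => f t + g t).
Proof.
move=> cf cg i; rewrite (_ : (fun _ => _) = fun t => f t ord0 i + g t ord0 i).
  exact: cadlagRD.
by apply/funext => t; rewrite mxE.
Qed.

Lemma cadlag_comp f (phi : R -> R) : cadlag f ->
  (forall t, 0 <= t -> 0 <= phi t) -> {homo phi : x y / x <= y} ->
  continuous phi -> cadlag (f \o phi).
Proof. by move=> cf p0 ph pc i; exact: (cadlagR_comp (cf i)). Qed.

End Cadlag.

Section PathPointed.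
Variables (R : realType) (n : nat).
Definition cpath := {f : R -> 'rV[R]_n | cadlag f}.
HB.instance Definition _ := gen_eqMixin cpath.
HB.instance Definition _ := gen_choiceMixin cpath.
HB.instance Definition _ :=
  isPointed.Build cpath (exist _ _ (@cadlag_cst R n 0)).
End PathPointed.

Definition coord_sets (R : realType) (n : nat) : set (set (cpath R n)) :=
  [set A | exists (t : R) (i : 'I_n) (B : set R),
     [/\ 0 <= t, measurable B & A = [set f : cpath R n | B (sval f t ord0 i)]] ].

(* The Skorokhod space as a [measurableType]; [Dsigma] is its image
   under [pval]. *)
Definition pathsp (R : realType) (n : nat) :=
  @g_sigma_algebraType (cpath R n) (@coord_sets R n).

HB.instance Definition _ (R : realType) (n : nat) := Measurable.on (pathsp R n).

Section PathSpace.
Context {R : realType} {n : nat}.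
Local Notation E := (pathsp R n).

Definition pval (p : E) : R -> 'rV[R]_n := sval p.

(** A total constructor: a function that is not càdlàg yields the default path. The [pval_] lemmas
    below show that this does not occur for admissible times. *)
Definition mkpath (f : R -> 'rV[R]_n) : E :=
  if pselect (cadlag f) is left h then exist _ f h else point.

Lemma cadlag_pval (p : E) : cadlag (pval p).
Proof. by case: p. Qed.

Lemma mkpathK f : cadlag f -> pval (mkpath f) = f.
Proof. by move=> cf; rewrite /mkpath; case: pselect. Qed.

Lemma pval_inj : injective pval.
Proof. by move=> [f cf] [g cg] /= fg; exact: eq_exist. Qed.

Lemma pvalK p : mkpath (pval p) = p.
Proof. by apply: pval_inj; rewrite mkpathK//; exact: cadlag_pval. Qed.

Lemma measurable_pval t i : 0 <= t ->
  measurable_fun [set: E] (fun p => pval p t ord0 i).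
Proof.
move=> t0 _ B mB; rewrite setTI; apply: sub_sigma_algebra.
by exists t, i, B.
Qed.

Lemma measurable_to_path d (T : measurableType d) (g : T -> E) :
  (forall t i, 0 <= t -> measurable_fun setT (fun w => pval (g w) t ord0 i)) ->
  measurable_fun setT g.
Proof.
move=> mg; apply: (@measurability _ _ T E setT g (@coord_sets R n)) => //.
move=> _ [_ [t [i [B [t0 mB ->]]]] <-].
by have := mg t i t0 measurableT B mB.
Qed.

(** Coordinate sets look only at times t >= 0, and the sets that do not separate f from g form a
    sigma-field. *)
Lemma path_ext (f g : E) (A : set E) : measurable A ->
  (forall t, 0 <= t -> pval f t = pval g t) -> A f <-> A g.
Proof.
move=> mA fg; pose S := [set A : set E | A f <-> A g].
suff : <<s @coord_sets R n>> `<=` S by exact.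
apply: smallest_sub.
  split => [//|B|F SF]; first by rewrite /S /= /setD/=; tauto.
  by split => -[k _ Fk]; exists k => //; apply/SF.
by move=> _ [t [i [B [t0 mB ->]]]]; rewrite /S /= -!/(pval _) fg.
Qed.

Lemma Dsigma_pval A : Dsigma A -> measurable (pval @^-1` A).
Proof.
move: A; apply: smallest_sub.
  split => [|A|F mF] /=.
  - by rewrite preimage_set0.
  - move=> mA; rewrite (_ : _ @^-1` _ = ~` (pval @^-1` A)).
      exact: measurableC.
    by apply/seteqP; split => p /=; [case|split => //; exact: cadlag_pval].
  - by rewrite preimage_bigcup; exact: bigcupT_measurable.
move=> _ [t [i [B [t0 [mB ->]]]]] /=.
rewrite (_ : _ @^-1` _ = (fun p => pval p t ord0 i) @^-1` B).
  by rewrite -[X in measurable X]setTI; exact: measurable_pval.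
by apply/seteqP; split => p /=; [case|split => //; exact: cadlag_pval].
Qed.

(** Images commute with complements here because [pval] is injective with range [Dpaths]. *)
Lemma Dsigma_image (C : set E) : measurable C -> Dsigma (pval @` C).
Proof.
move: C; apply: smallest_sub.
  split => [|C DC|F mF] /=.
  - by rewrite image_set0; exact: sigma_algebra0.
  - rewrite (_ : _ @` _ = @Dpaths R n `\` (pval @` C)).
      exact: sigma_algebraCD.
    apply/seteqP; split => [_ [p [_ Cp] <-]|f [cf Cf]].
      by split; [exact: cadlag_pval|move=> [q Cq /pval_inj qp]; rewrite qp in Cq].
    exists (mkpath f); rewrite ?mkpathK//; split => // Cp; apply: Cf.
    by exists (mkpath f); rewrite ?mkpathK.
  - by rewrite image_bigcup; exact: sigma_algebra_bigcup.
move=> _ [t [i [B [t0 mB ->]]]] /=.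
apply: sub_sigma_algebra; exists t, i, B; split => //; split => //.
apply/seteqP; split => [_ [p Bp <-]|f [cf Bf]].
  by split => //; exact: cadlag_pval.
by exists (mkpath f); rewrite ?mkpathK//= -[sval _]/(pval _) mkpathK.
Qed.

Lemma Dmeas_nonnegP (H : (R -> 'rV[R]_n) -> \bar R) :
  Dmeas_nonneg H <->
  (forall p, 0 <= H (pval p))%E /\ measurable_fun setT (H \o pval).
Proof.
split => [[H0 mH]|[H0 mH]]; split.
- by move=> p; apply: H0; exact: cadlag_pval.
- move=> _ B mB; rewrite setTI; have /Dsigma_pval := mH _ mB.
  rewrite preimage_setI (_ : _ @^-1` @Dpaths R n = setT) ?setTI//.
  by apply/seteqP; split => // p _; exact: cadlag_pval.
- by move=> f cf; rewrite -(mkpathK cf).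
- move=> B mB; have := mH measurableT B mB; rewrite setTI => /Dsigma_image.
  congr Dsigma; apply/seteqP; split => [_ [p Bp <-]|f [cf Bf]].
    by split => //; exact: cadlag_pval.
  by exists (mkpath f); rewrite /= mkpathK.
Qed.

Lemma measurable_eval d (T : measurableType d) (g : T -> E) (tau : T -> R) i :
  measurable_fun setT g -> measurable_fun setT tau -> (forall w, 0 <= tau w) ->
  measurable_fun setT (fun w => pval (g w) (tau w) ord0 i).
Proof.
move=> mg mt t0.
apply: (@measurable_random_time _ _ _ (fun t w => pval (g w) t ord0 i)) => //.
- by move=> t t00; exact: (measurableT_comp (measurable_pval i t00) mg).
- by move=> w; exact: cadlag_pval.
Qed.

Definition deltap (r : R) (p : E) : E :=
  mkpath (fun s => pval p (r + s) - pval p r).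
Definition stopp (r : R) (p : E) : E := mkpath (fun s => pval p (Num.min s r)).
(** Inverse to cutting a path at r into [stopp r p] and [deltap r p]: up to time r, [f] contributes
    only its value at 0, which vanishes for increments. *)
Definition catp (g : E) (r : R) (f : E) : E :=
  mkpath (fun s => pval g s + pval f (Num.max (s - r) 0)).
Definition addp (g f : E) : E := mkpath (fun s => pval g s + pval f s).
Definition constp (x : 'rV[R]_n) : E := mkpath (fun=> x).

Lemma pval_deltap r p s : 0 <= r ->
  pval (deltap r p) s = pval p (r + s) - pval p r.
Proof.
move=> r0; rewrite mkpathK//; apply: cadlagD; last exact: cadlag_cst.
apply: (@cadlag_comp _ _ (pval p) (fun s => r + s)).
- exact: cadlag_pval.
- by move=> t t0; exact: addr_ge0.
- by move=> x y xy; rewrite lerD2l.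
- by move=> x; apply: cvgD; [exact: cvg_cst|exact: cvg_id].
Qed.

Lemma pval_stopp r p s : 0 <= r -> pval (stopp r p) s = pval p (Num.min s r).
Proof.
move=> r0; rewrite mkpathK//.
apply: (@cadlag_comp _ _ (pval p) (fun s => Num.min s r)).
- exact: cadlag_pval.
- by move=> t t0; rewrite le_min t0.
- by move=> x y xy; rewrite le_min !ge_min xy lexx orbT.
- by move=> x; apply: cvg_minr; [exact: cvg_id|exact: cvg_cst].
Qed.

Lemma pval_catp g r f s :
  pval (catp g r f) s = pval g s + pval f (Num.max (s - r) 0).
Proof.
rewrite mkpathK//; apply: cadlagD; first exact: cadlag_pval.
apply: (@cadlag_comp _ _ (pval f) (fun s => Num.max (s - r) 0)).
- exact: cadlag_pval.
- by move=> t t0; rewrite le_max lexx orbT.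
- by move=> x y xy; rewrite ge_max !le_max lexx orbT lerD2r xy.
- move=> x; apply: cvg_maxr; last exact: cvg_cst.
  by apply: cvgD; [exact: cvg_id|exact: cvg_cst].
Qed.

Lemma pval_addp g f s : pval (addp g f) s = pval g s + pval f s.
Proof. by rewrite mkpathK//; apply: cadlagD; exact: cadlag_pval. Qed.

Lemma pval_constp x s : pval (constp x) s = x.
Proof. by rewrite mkpathK//; exact: cadlag_cst. Qed.

Context d (T : measurableType d).
Implicit Types (tau : T -> R) (f g : T -> E).

Lemma measurable_deltap tau g :
  measurable_fun setT tau -> (forall w, 0 <= tau w) -> measurable_fun setT g ->
  measurable_fun setT (fun w => deltap (tau w) (g w)).
Proof.
move=> mt t0 mg; apply: measurable_to_path => s i s0.
under eq_fun do rewrite pval_deltap// !mxE.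
apply: measurable_funB; apply: measurable_eval => //.
- by apply: measurable_funD => //; exact: measurable_cst.
- by move=> w; exact: addr_ge0.
Qed.

Lemma measurable_stopp tau g :
  measurable_fun setT tau -> (forall w, 0 <= tau w) -> measurable_fun setT g ->
  measurable_fun setT (fun w => stopp (tau w) (g w)).
Proof.
move=> mt t0 mg; apply: measurable_to_path => s i s0.
under eq_fun do rewrite pval_stopp//.
apply: measurable_eval => //.
- by apply: measurable_minr => //; exact: measurable_cst.
- by move=> w; rewrite le_min s0 t0.
Qed.

Lemma measurable_catp tau f g :
  measurable_fun setT tau -> measurable_fun setT f -> measurable_fun setT g ->
  measurable_fun setT (fun w => catp (g w) (tau w) (f w)).
Proof.
move=> mt mf mg; apply: measurable_to_path => s i s0.
under eq_fun do rewrite pval_catp !mxE.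
apply: measurable_funD; apply: measurable_eval => //.
- by apply: measurable_maxr => //; apply: measurable_funB.
- by move=> w; rewrite le_max lexx orbT.
Qed.

Lemma measurable_addp f g :
  measurable_fun setT f -> measurable_fun setT g ->
  measurable_fun setT (fun w => addp (g w) (f w)).
Proof.
move=> mf mg; apply: measurable_to_path => s i s0.
under eq_fun do rewrite pval_addp !mxE.
by apply: measurable_funD; apply: measurable_eval.
Qed.

End PathSpace.

Opaque mkpath deltap stopp catp addp constp.

(** * Generating pi-systems of the path space *)

Section AlmostSureEquality.
Context {R : realType} d (T : measurableType d)
  (mu : {measure set T -> \bar R}).

Lemma ae_iff_measure (A B : set T) : measurable A -> measurable B ->
  {ae mu, forall w, A w <-> B w} -> mu A = mu B.
Proof.
move=> mA mB [N [mN N0 AB]].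
have sub (C D : set T) : measurable C -> measurable D ->
    (forall w, ~ N w -> C w -> D w) -> (mu C <= mu D)%E.
  move=> mC mD CD.
  have : (mu C <= mu (D `|` N))%E.
    apply: le_measure; rewrite ?inE//; first exact: measurableU.
    by move=> w Cw; have [?|?] := pselect (N w); [right|left; exact: CD].
  move=> /le_trans; apply; apply: (le_trans (measureU2 _ _ _)) => //.
  by rewrite [X in (_ + X <= _)%E](_ : _ = 0%E) ?adde0//; exact: N0.
have iff w : ~ N w -> A w <-> B w by move=> Nw; apply: contrapT => h; exact/Nw/AB.
by apply/eqP; rewrite eq_le !sub// => w /iff[].
Qed.

End AlmostSureEquality.

Section Cylinders.
Context {R : realType} {n : nat}.
Local Notation E := (pathsp R n).
Implicit Types (l : seq (R * 'I_n * R)).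

(** Open half-lines suffice to generate the Borel sets, and strict lower bounds can be expressed by
    positivity of one continuous function of finitely many coordinates, as the passage to the limit
    in [strong_markov] requires. *)
Definition cyl l : set E :=
  [set p | forall x, x \in l -> x.2 < pval p x.1.1 ord0 x.1.2].

Definition times_ge0 l := all (fun x : R * 'I_n * R => 0 <= x.1.1) l.

Lemma cyl_cons x l :
  cyl (x :: l) = [set p | x.2 < pval p x.1.1 ord0 x.1.2] `&` cyl l.
Proof.
apply/seteqP; split => [p h|p [h1 h2] y].
  by split; [apply: h; rewrite mem_head|move=> y yl; apply: h; rewrite inE yl orbT].
by rewrite inE => /predU1P[->|]; [exact: h1|exact: h2].
Qed.

Lemma cyl_cat l1 l2 : cyl (l1 ++ l2) = cyl l1 `&` cyl l2.
Proof.
elim: l1 => [|x l1 IH] /=; last by rewrite !cyl_cons IH setIA.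
by rewrite [cyl [::]](_ : _ = setT) ?setTI//; apply/seteqP; split.
Qed.

Lemma cyl_measurable l : times_ge0 l -> measurable (cyl l).
Proof.
elim: l => [_|x l IH /andP[x0 /IH ml]].
  by rewrite [cyl _](_ : _ = setT)//; apply/seteqP; split.
rewrite cyl_cons; apply: measurableI => //.
have := @measurable_pval R n _ x.1.2 x0 measurableT `]x.2, +oo[%classic.
rewrite setTI => /(_ (measurable_itv _)); congr measurable.
by apply/seteqP; split => p /=; rewrite in_itv/= andbT.
Qed.

Lemma eq_on_cylinders (m1 m2 : {measure set E -> \bar R}) : (m1 setT < +oo)%E ->
  (forall l, times_ge0 l -> m1 (cyl l) = m2 (cyl l)) ->
  forall C, measurable C -> m1 C = m2 C.
Proof.
move=> m1fin m12; pose G := [set C | exists2 l, times_ge0 l & C = cyl l].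
have GT : G setT by exists [::] => //; apply/seteqP; split.
apply: (@measure_unique _ _ _ G (fun=> setT)) => //.
- apply/seteqP; split; apply: smallest_sub => //.
  + move=> _ [t [i [B [t0 mB ->]]]].
    pose f (p : g_sigma_algebraType G) := pval p t ord0 i.
    suff mf : measurable_fun setT f by have := mf measurableT B mB; rewrite setTI.
    apply: (measurability _ (RGenOInfty.measurableE R)).
    move=> _ [_ [x ->] <-]; apply: sub_sigma_algebra.
    exists [:: (t, i, x)]; first by rewrite /times_ge0 /= t0.
    apply/seteqP; split => p /=.
      by rewrite in_itv/= andbT => -[_ h] y; rewrite inE => /eqP ->.
    by move=> /(_ (t, i, x) (mem_head _ _)) h; split => //; rewrite in_itv/= andbT.
  + exact: sigma_algebra_measurable.
  + by move=> _ [l l0 ->]; exact: cyl_measurable.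
- move=> _ _ [l1 h1 ->] [l2 h2 ->]; exists (l1 ++ l2); last by rewrite cyl_cat.
  by rewrite /times_ge0 all_cat; apply/andP.
- exact: bigcup_const.
- by move=> _ [l l0 ->]; exact: m12.
Qed.

Definition increments (u : nat -> R) m (b : nat -> 'I_n -> set R) : set E :=
  [set p | forall j, (j < m)%N -> forall i,
     b j i (pval p (u j.+1) ord0 i - pval p (u j) ord0 i)].

(* Along a fixed grid the increment sets form a pi-system, which generates
   the values at the grid points relative to the starting point. *)
Lemma eq_on_increments (m1 m2 : {measure set E -> \bar R}) (u : nat -> R) m :
  u 0%N = 0 -> (forall j, 0 <= u j) -> (m1 setT < +oo)%E ->
  (forall b, (forall j i, measurable (b j i)) ->
    m1 (increments u m b) = m2 (increments u m b)) ->
  forall l, times_ge0 l ->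
    (forall x, x \in l -> exists2 j, (j <= m)%N & x.1.1 = u j) ->
  let D := [set p | forall x, x \in l ->
       x.2 < pval p x.1.1 ord0 x.1.2 - pval p 0 ord0 x.1.2] in
  m1 D = m2 D.
Proof.
move=> u00 u0 m1fin m12 l l0 lu D.
pose G := [set C | exists2 b, (forall j i, measurable (b j i)) &
  C = increments u m b].
have GT : G setT by exists (fun _ _ => setT) => //; apply/seteqP; split.
have Gm : G `<=` measurable.
  move=> _ [b mb ->].
  rewrite (_ : increments _ _ _ = \bigcap_(j in `I_m) \bigcap_(i in [set: 'I_n])
     [set p | b j i (pval p (u j.+1) ord0 i - pval p (u j) ord0 i)]).
    apply: bigcap_measurableType => j _.
    apply: fin_bigcap_measurable; first exact: finite_finset.
    move=> i _; rewrite -[X in measurable X]setTI.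
    by apply: (measurable_funB (measurable_pval i (u0 _))
      (measurable_pval i (u0 _))).
  apply/seteqP; split => p h j jm i; first by move=> _; exact: h.
  exact: (h j jm i I).
have GI : setI_closed G.
  move=> _ _ [b mb ->] [c mc ->]; exists (fun j i => b j i `&` c j i).
    by move=> j i; exact: measurableI.
  apply/seteqP; split => [p [h1 h2] j jm i|p h].
    by split; [exact: h1|exact: h2].
  by split => j jm i; have [] := h j jm i.
apply: (@g_sigma_algebra_measure_unique _ _ _ G Gm (fun=> setT)) => //.
  exact: bigcup_const.
  by move=> _ [b mb ->]; exact: m12.
(* Telescoping: the value at [u j] relative to time 0 is a sum of successive increments. Each is
   measurable for the sigma-field generated by [G], by constraining one coordinate of one increment
   and leaving all other conditions vacuous. *)
have mincr j i : (j <= m)%N -> measurable_fun [set: g_sigma_algebraType G]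
    (fun p => pval p (u j) ord0 i - pval p 0 ord0 i).
  elim: j => [|j IH] jm.
    by under eq_fun do rewrite u00 subrr; exact: measurable_cst.
  rewrite (_ : (fun p : g_sigma_algebraType G => _) = (fun p : g_sigma_algebraType G =>
      (pval p (u j.+1) ord0 i - pval p (u j) ord0 i) +
      (pval p (u j) ord0 i - pval p 0 ord0 i))); last first.
    by apply/funext => p; rewrite addrA subrK.
  apply: measurable_funD; last by apply: IH; exact: ltnW.
  move=> _ B mB; rewrite setTI; apply: sub_sigma_algebra.
  exists (fun k i' => if (k == j) && (i' == i) then B else setT).
    by move=> k i'; case: ifP.
  apply/seteqP; split => p /=.
    by move=> h k km i'; case: ifP => // /andP[/eqP -> /eqP ->].
  by move=> /(_ j jm i); rewrite !eqxx.
rewrite /D; elim: l l0 lu {D} => [|x l IH /andP[/= x0 l0] lu].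
  by move=> _ _; rewrite (_ : mkset _ = setT); [exact: sub_sigma_algebra|apply/seteqP; split].
rewrite (_ : mkset _ =
    [set p | x.2 < pval p x.1.1 ord0 x.1.2 - pval p 0 ord0 x.1.2] `&`
    [set p | forall x, x \in l ->
       x.2 < pval p x.1.1 ord0 x.1.2 - pval p 0 ord0 x.1.2]); last first.
  apply/seteqP; split => [p h|p [h1 h2] y].
    by split; [apply: h; rewrite mem_head|move=> y yl; apply: h; rewrite inE yl orbT].
  by rewrite inE => /predU1P[->|]; [exact: h1|exact: h2].
apply: (@measurableI _ (g_sigma_algebraType G)).
  have [j jm ->] := lu x (mem_head _ _).
  have := mincr j x.1.2 jm measurableT `]x.2, +oo[%classic (measurable_itv _).
  rewrite setTI; congr (<<s _>> _).
  by apply/seteqP; split => p /=; rewrite in_itv/= andbT.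
by apply: IH => // y yl; apply: lu; rewrite inE yl orbT.
Qed.

End Cylinders.

(** * The Markov property at deterministic times *)

Section SubSigma.
Context {R : realType} d (Omega : measurableType d).

Lemma gsigma_measurable_fun (S : set (set Omega)) d' (T : measurableType d')
    (f : Omega -> T) : sigma_algebra setT S ->
  measurable_fun (setT : set (g_sigma_algebraType S)) f <->
  (forall B, measurable B -> S (f @^-1` B)).
Proof.
move=> sS; split => [mf B mB|mf _ B mB].
  have := mf measurableT B mB; rewrite setTI.
  by rewrite -[X in X _ -> _]/(S.-sigma.-measurable) measurable_g_measurableTypeE.
by rewrite setTI measurable_g_measurableTypeE//; exact: mf.
Qed.

End SubSigma.

Section Levy.
Context {R : realType} d (Omega : measurableType d) (P : probability Omega R)
  (n : nat) (F : R -> set (set Omega)) (X : R -> Omega -> 'rV[R]_n)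
  (hF : filtration F) (hX : levy P F X).
Local Notation E := (pathsp R n).

Definition Xpath (w : Omega) : E := mkpath (X ^~ w).

Lemma pval_Xpath w : pval (Xpath w) = X ^~ w.
Proof. by apply: mkpathK; have [_ [+ _]] := hX; exact. Qed.

Lemma borelRn_coord (i : 'I_n) (B : set R) : measurable B ->
  borelRn [set v : 'rV[R]_n | B (v ord0 i)].
Proof. by move=> mB; apply: sub_sigma_algebra; exists i, B. Qed.

Lemma filtration_sigma t : 0 <= t -> sigma_algebra setT (F t).
Proof. by have [+ _] := hF; exact. Qed.

Lemma filtration_setT t : 0 <= t -> F t setT.
Proof.
move=> t0; have [h0 hC _] := filtration_sigma t0.
by rewrite -[setT]setD0; exact: hC.
Qed.

Lemma filtration_measurable t A : 0 <= t -> F t A -> measurable A.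
Proof. by move=> t0; have [_ [_ +]] := hF; apply. Qed.

Lemma filtration_le s t A : 0 <= s -> s <= t -> F s A -> F t A.
Proof. by move=> s0 st; have [_ [+ _]] := hF; apply. Qed.

Lemma levy_adapted s t i : 0 <= s -> s <= t ->
  measurable_fun (setT : set (g_sigma_algebraType (F t))) (fun w => X s w ord0 i).
Proof.
move=> s0 st; apply/gsigma_measurable_fun.
  exact/filtration_sigma/(le_trans s0).
move=> B mB; apply: (filtration_le s0 st).
by have [+ _] := hX; move=> /(_ s s0 _ (borelRn_coord i mB)).
Qed.

Lemma filtration_measurable_fun t d' (T : measurableType d') (f : Omega -> T) :
  0 <= t -> measurable_fun (setT : set (g_sigma_algebraType (F t))) f ->
  measurable_fun setT f.
Proof.
move=> t0 /gsigma_measurable_fun mf _ B mB; rewrite setTI.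
by apply: (filtration_measurable t0); apply: mf => //; exact: filtration_sigma.
Qed.

Lemma measurable_Xpath : measurable_fun setT Xpath.
Proof.
apply: measurable_to_path => t i t0; rewrite (_ : (fun _ => _) = fun w => X t w ord0 i).
  exact: (filtration_measurable_fun t0 (levy_adapted i t0 (lexx t))).
by apply/funext => w; rewrite pval_Xpath.
Qed.

Definition levy_law := image_measure P measurable_Xpath.
HB.instance Definition _ := Probability.on levy_law.

Lemma levy_ind_step s t A (b : 'I_n -> set R) : 0 <= s -> s <= t -> F s A ->
  (forall i, measurable (b i)) ->
  let I := [set w | forall i, b i (X t w ord0 i - X s w ord0 i)] in
  F t I /\
  P (A `&` I) = (P A * P [set w | forall i, b i (X (t - s)%R w ord0 i)])%E.
Proof.
move=> s0 st FA mb I; have t0 := le_trans s0 st; split.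
  rewrite (_ : I = \bigcap_(i in [set: 'I_n])
      [set w | b i (X t w ord0 i - X s w ord0 i)]); last first.
    by apply/seteqP; split => w h i; [move=> _; exact: h|exact: (h i)].
  rewrite -(measurable_g_measurableTypeE (filtration_sigma t0)).
  apply: fin_bigcap_measurable; first exact: finite_finset.
  move=> i _; rewrite -[X in measurable X]setTI.
  by apply: (measurable_funB (levy_adapted i t0 (lexx t)) (levy_adapted i s0 st)).
pose B := [set v : 'rV[R]_n | forall i, b i (v ord0 i)].
have bB : borelRn B.
  rewrite (_ : B = \bigcap_(i in [set: 'I_n]) [set v | b i (v ord0 i)]); last first.
    by apply/seteqP; split => w h i; [move=> _; exact: h|exact: (h i)].
  apply: (@fin_bigcap_measurable _ (g_sigma_algebraType _)).
    exact: finite_finset.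
  by move=> i _; exact: borelRn_coord.
have [_ [_ [_ /(_ s t s0 st B A bB FA)]]] := hX.
rewrite [LHS](_ : _ = P (A `&` I)); last first.
  congr (P _); rewrite setIC; congr (_ `&` _).
  by apply/seteqP; split => w h i; have := h i; rewrite !mxE.
by move=> ->; rewrite muleC.
Qed.

(** The membership in [F (s + u m)] drives the induction: what has been observed so far serves as
    the past event for the next increment. The product depends on the lengths of the steps only,
    hence not on s. *)
Lemma levy_increments (u : nat -> R) m s A (b : nat -> 'I_n -> set R) :
  0 <= s -> F s A -> u 0%N = 0 -> (forall j, (j < m)%N -> u j <= u j.+1) ->
  (forall j, 0 <= u j) -> (forall j i, measurable (b j i)) ->
  let I := [set w | forall j, (j < m)%N -> forall i,
     b j i (X (s + u j.+1) w ord0 i - X (s + u j) w ord0 i)] in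
  F (s + u m) (A `&` I) /\
  P (A `&` I) = (P A * \prod_(j < m)
     P [set w | forall i, b j i (X (u j.+1 - u j)%R w ord0 i)])%E.
Proof.
move=> s0 FA u00 um u0 mb.
elim: m um => [|m IH] um I.
  rewrite (_ : I = setT); last by apply/seteqP; split.
  by rewrite setIT u00 addr0 big_ord0 mule1.
have [IH1 IH2] := IH (fun j jm => um j (ltnW jm)).
have le_um := um m (ltnSn m).
have sm0 : 0 <= s + u m by rewrite addr_ge0.
have smm : s + u m <= s + u m.+1 by rewrite lerD2l.
have [F1 P1] := levy_ind_step sm0 smm IH1 (mb m).
set J := (X in A `&` X) in IH1 IH2 F1 P1.
set K := [set w | _] in F1 P1.
have -> : A `&` I = A `&` J `&` K.
  rewrite -setIA; congr (_ `&` _); apply/seteqP; split => [w h|w [h1 h2] j].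
    by split; [move=> j jm; apply: h; exact: ltnW|exact: h].
  by rewrite ltnS leq_eqVlt => /predU1P[->|]; [exact: h2|exact: h1].
split.
  rewrite -(measurable_g_measurableTypeE (filtration_sigma (addr_ge0 s0 (u0 m.+1)))).
  apply: measurableI; rewrite measurable_g_measurableTypeE//;
    try exact/filtration_sigma/addr_ge0.
  exact: filtration_le IH1.
rewrite P1 IH2 big_ord_recr/= muleA; congr (_ * P _)%E.
by rewrite [X in X - _]addrC opprD addrA addrK.
Qed.

Lemma measurable_delta_Xpath s : 0 <= s ->
  measurable_fun setT (fun w => deltap s (Xpath w)).
Proof. by move=> s0; apply: measurable_deltap => //; exact: measurable_Xpath. Qed.

Lemma delta_Xpath_increments (u : nat -> R) m s (b : nat -> 'I_n -> set R) :
  0 <= s ->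
  (fun w => deltap s (Xpath w)) @^-1` increments u m b =
  [set w | forall j, (j < m)%N -> forall i,
     b j i (X (s + u j.+1) w ord0 i - X (s + u j) w ord0 i)].
Proof.
move=> s0; apply/seteqP; split => w h j jm i; have := h j jm i;
by rewrite !(pval_deltap _ _ s0) pval_Xpath !mxE /= opprB addrA subrK.
Qed.

(** X_0 = 0 holds only almost surely, so subtracting the initial value may change the path but not
    its law. *)
Lemma levy_delta0 C : measurable C ->
  P ((fun w => deltap 0 (Xpath w)) @^-1` C) = levy_law C.
Proof.
move=> mC; rewrite /levy_law /image_measure /pushforward.
apply: ae_iff_measure.
- by rewrite -[X in measurable X]setTI; exact: measurable_delta_Xpath.
- by rewrite -[X in measurable X]setTI; exact: measurable_Xpath.
have [_ [_ [X0 _]]] := hX.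
apply: filterS X0 => w X0.
apply: path_ext => // t t0.
by rewrite pval_deltap// pval_Xpath add0r X0 subr0.
Qed.

(** As measures in [C] the two sides agree on increments along any grid starting at 0; a grid
    containing the times of a given cylinder then settles that cylinder. *)
Lemma levy_indep s A C : 0 <= s -> F s A -> measurable C ->
  P (A `&` (fun w => deltap s (Xpath w)) @^-1` C) = (P A * levy_law C)%E.
Proof.
move=> s0 FA; have mA := filtration_measurable s0 FA.
have PA0 : 0 <= fine (P A) by rewrite fine_ge0.
have PAE : (fine (P A))%:E = P A by rewrite fineK// fin_num_measure.
pose m1 : {measure set E -> \bar R} := image_measure (mrestr P mA) (measurable_delta_Xpath s0).
(* The comparison measure uses increments after time 0 rather than X itself, so that
   [levy_increments] evaluates both measures by the same product. *)
pose m2 : {measure set E -> \bar R} :=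
  mscale (NngNum PA0) (image_measure P (measurable_delta_Xpath (lexx 0))).
have m1E C' : m1 C' = P (A `&` (fun w => deltap s (Xpath w)) @^-1` C').
  by rewrite /m1 /image_measure /pushforward /mrestr setIC.
have m2E C' : m2 C' = (P A * P ((fun w => deltap 0 (Xpath w)) @^-1` C'))%E.
  by rewrite /m2 /= /mscale /= PAE.
clearbody m1 m2.
suff m12 : forall C', measurable C' -> m1 C' = m2 C'.
  by move=> mC; rewrite -m1E (m12 _ mC) m2E (levy_delta0 mC).
have m1fin : (m1 setT < +oo)%E.
  by rewrite m1E preimage_setT setIT -PAE ltry.
apply: (@eq_on_cylinders _ _ m1 m2) => // l l0.
(* The grid is 0 followed by the sorted times of [l]; repeated times give increments of length 0.
   Past the end [u] takes the default 0, so monotonicity is claimed only up to [size ts]. *)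
pose ts := sort <=%R [seq x.1.1 | x <- l].
pose u j := nth 0 (0 :: ts) j.
have ts0 : all (fun t => 0 <= t) ts.
  apply/allP => t; rewrite mem_sort => /mapP[x xl ->].
  by move/allP : l0 => /(_ _ xl).
have pts : path <=%R 0 ts by rewrite path_min_sorted//; exact/sort_sorted/le_total.
have u0 j : 0 <= u j.
  case: j => [|j] //; rewrite /u /=.
  have [jt|jt] := ltnP j (size ts); last by rewrite nth_default.
  by move/allP : ts0; apply; exact: mem_nth.
have um j : (j < size ts)%N -> u j <= u j.+1 by move=> jt; move/(pathP 0) : pts; exact.
have := @eq_on_increments _ _ m1 m2 u (size ts) erefl u0 m1fin.
have H b : (forall j i, measurable (b j i)) ->
    m1 (increments u (size ts) b) = m2 (increments u (size ts) b).
  move=> mb; rewrite m1E m2E (delta_Xpath_increments _ _ _ s0).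
  rewrite (delta_Xpath_increments _ _ _ (lexx 0)).
  have [_ ->] := levy_increments s0 FA erefl um u0 mb.
  have [_ sT] := @levy_increments u (size ts) 0 setT b (lexx 0)
    (filtration_setT (lexx 0)) erefl um u0 mb.
  by move: sT; rewrite setTI probability_setT mul1e => ->.
move=> /(_ H l l0); set D := mkset _ => m12D.
(* Paths of the form [deltap s p] start at 0, so values relative to the start are the values
   themselves. *)
have D1 : m1 D = m1 (cyl l).
  rewrite !m1E; congr (P (_ `&` _)); apply/seteqP; split => w h x xl; have := h x xl;
  by rewrite !(pval_deltap _ _ s0) addr0 subrr !mxE subr0.
have D2 : m2 D = m2 (cyl l).
  rewrite !m2E; congr (_ * P _)%E; apply/seteqP; split => w h x xl; have := h x xl;
  by rewrite !(pval_deltap _ _ (lexx 0)) addr0 subrr !mxE subr0.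
rewrite -D1 -D2; apply: m12D => x xl.
have xt : x.1.1 \in ts by rewrite mem_sort; exact: map_f xl.
exists (index x.1.1 ts).+1; first by rewrite index_mem.
by rewrite /u /= nth_index.
Qed.

End Levy.

(** * Completions and the sigma-field at a random time *)

Section Completion.
Context {R : realType} d (Omega : measurableType d) (P : probability Omega R).
Implicit Types (S : set (set Omega)) (A : set Omega).

(** Measurable sets that are almost surely equal to a member of [S] form a sigma-field containing
    [S] and the null sets. This is what lets independence from F_t pass to the completed
    filtration. *)
Lemma completion_ae S A : sigma_algebra setT S -> S `<=` measurable ->
  completion P S A ->
  measurable A /\ exists2 A', S A' & {ae P, forall w, A w <-> A' w}.
Proof.
move=> sS mS; move: A; apply: smallest_sub.
  split => [|A [mA [A' SA' AA']]|A hA].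
  - by split => //; exists set0; [case: sS|exact: aeW].
  - split; first by rewrite setTD; exact: measurableC.
    exists (setT `\` A'); first by have [_ SC _] := sS; exact: SC.
    by apply: filterS AA' => w [h1 h2]; split => -[_ h]; split => // ?; apply: h; auto.
  - split; first by apply: bigcupT_measurable => k; have [] := hA k.
    have /choice[A' HA'] : forall k, exists B, S B /\
        {ae P, forall w, A k w <-> B w}.
      by move=> k; have [_ [A' ? ?]] := hA k; exists A'.
    exists (\bigcup_k A' k).
      by have [_ _ SU] := sS; apply: SU => k; have [] := HA' k.
    have /ae_foralln : forall k, \forall w \ae P, A k w <-> A' k w.
      by move=> k; have [] := HA' k.
    apply: filterS => w h; split => -[k _ hk]; exists k => //; exact/h.
move=> A [SA|[mA PA]].
  by split; [exact: mS|exists A => //; exact: aeW].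
split => //; exists set0; first by case: sS.
by exists A; split => // w /= h; apply: contrapT => Aw; apply: h; split.
Qed.

Lemma completion_of_ae S A A' : measurable A -> S A' ->
  {ae P, forall w, A w <-> A' w} -> completion P S A.
Proof.
move=> mA SA' [N [mN PN AN]].
pose T := g_sigma_algebraType (S `|` Pnull P).
have sub B : measurable B -> P B = 0%E -> (measurable : set (set T)) B.
  by move=> mB PB; apply: sub_sigma_algebra; right.
suff -> : A = (A' `\` N) `|` (A `&` N).
  apply: (@measurableU _ T).
    by apply: (@measurableD _ T); [apply: sub_sigma_algebra; left|exact: sub].
  apply: sub; first exact: measurableI.
  apply/eqP; rewrite eq_le measure_ge0 andbT -PN.
  by apply: le_measure; rewrite ?inE//; exact: measurableI.
have iff w : ~ N w -> A w <-> A' w by move=> Nw; apply: contrapT => h; exact/Nw/AN.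
apply/seteqP; split => w.
  by have [Nw Aw|Nw /(iff _ Nw)] := pselect (N w); [right|left].
by move=> [[/[swap] /iff h /h]|[]].
Qed.

Lemma completion_sub S S' : S `<=` S' -> completion P S `<=` completion P S'.
Proof. by move=> SS'; apply: sub_sigma_algebra2; exact: setSU. Qed.

End Completion.

Section RandomTimeSigma.
Context {R : realType} d (Omega : measurableType d)
  (F : R -> set (set Omega)) (T : Omega -> \bar R)
  (hF : filtration F) (mT : measurable_fun setT T) (T0 : forall w, (0 <= T w)%E).

(** Takes the value 0 where [T] is infinite, so it represents [T] on [Tfin T] only. *)
Definition fT (w : Omega) : R := fine (T w).

Lemma fT_ge0 w : 0 <= fT w. Proof. exact: fine_ge0. Qed.

Lemma TfinE w : Tfin T w -> T w = (fT w)%:E.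
Proof. by move=> h; rewrite /fT fineK// ge0_fin_numE. Qed.

Lemma measurable_fT : measurable_fun setT fT.
Proof. exact: measurableT_comp. Qed.

Lemma measurable_Tfin : measurable (Tfin T).
Proof.
have := emeasurable_fun_infty_o measurableT mT +oo%E.
by rewrite setTI.
Qed.

Lemma FT'_sub G : FT' F T G -> G `<=` Tfin T.
Proof.
move: G; apply: smallest_sub.
  split => [|A _|A hA]; [exact: sub0set|by move=> w []|].
  by move=> w [k _]; exact: hA.
by move=> _ [Z [B [_ [_ ->]]]] w [].
Qed.

(** The sets of pairs (time, sample point) whose trace along the graph of [T] lies in K form a
    sigma-field, so an arbitrary optional process can be replaced by a single adapted càdlàg one. *)
Lemma FT'_min (K : set (set Omega)) : sigma_algebra (Tfin T) K ->
  (forall Y B, adapted_cadlag_real F Y -> measurable B ->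
     K (Tfin T `&` [set w | B (Y (fT w) w)])) ->
  FT' F T `<=` K.
Proof.
move=> [K0 KC KU] KY; apply: smallest_sub => // _ [Z [B [oZ [mB ->]]]].
pose Q := [set O : set (R * Omega) | K (Tfin T `&` [set w | O (fT w, w)])].
have sub : optional_sigma F `<=` Q.
  apply: smallest_sub.
    split => [|O KO|O hO].
    - by rewrite /Q /= (_ : [set w | _] = set0) ?setI0//; apply/seteqP; split.
    - have := KC _ KO; rewrite /Q /=; congr K.
      apply/seteqP; split => w [Tw h]; split => //.
        by split; [exact: fT_ge0|move=> Ow; exact: h].
      by case: h => _ h [_ /h].
    - have := KU _ hO; rewrite /Q /=; congr K.
      by apply/seteqP; split => w => [[k _ [Tw h]]|[Tw [k _ h]]]; [split|]; try exists k.
  move=> _ [Y [C [aY [mC ->]]]]; have := KY Y C aY mC; rewrite /Q /=; congr K.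
  by apply/seteqP; split => w [Tw] /= => [h|[]//]; split => //; split => //; exact: fT_ge0.
have := sub _ (oZ B mB); rewrite /Q /=; congr K.
by apply/seteqP; split => w [Tw] /= => [[]//|h]; split => //; split => //; exact: fT_ge0.
Qed.

Lemma adapted_measurable Y t : adapted_cadlag_real F Y -> 0 <= t ->
  measurable_fun setT (Y t).
Proof.
move=> [aY _] t0 _ B mB; rewrite setTI.
by have [_ [_ h]] := hF; apply: (h t t0); exact: aY.
Qed.

Lemma measurable_adapted_fT Y : adapted_cadlag_real F Y ->
  measurable_fun setT (fun w => Y (fT w) w).
Proof.
move=> aY; apply: measurable_random_time.
- by move=> t; exact: adapted_measurable.
- by case: aY.
- exact: measurable_fT.
- exact: fT_ge0.
Qed.

Lemma FT'_measurable : FT' F T `<=` measurable.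
Proof.
apply: FT'_min.
  split => // [A mA|A mA]; last exact: bigcupT_measurable.
  by apply: measurableD => //; exact: measurable_Tfin.
move=> Y B aY mB; apply: measurableI; first exact: measurable_Tfin.
by rewrite -[X in measurable X]setTI; exact: (measurable_adapted_fT aY).
Qed.

Lemma FT'_adapted Y B : adapted_cadlag_real F Y -> measurable B ->
  FT' F T (Tfin T `&` [set w | B (Y (fT w) w)]).
Proof.
move=> aY mB; apply: sub_sigma_algebra; exists Y, B; split => // C mC.
by apply: sub_sigma_algebra; exists Y, C.
Qed.

Lemma FT'_Tfin : FT' F T (Tfin T).
Proof. by rewrite -[X in FT' _ _ X]setD0; apply: sigma_algebraCD; exact: sigma_algebra0. Qed.

(* [FT'] is a sigma-field on [Tfin T]; this is the corresponding one on
   [Omega]. *)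
Definition FTfull : set (set Omega) :=
  [set G | measurable G /\ FT' F T (Tfin T `&` G)].

Lemma FTfull_sigma : sigma_algebra setT FTfull.
Proof.
split => [|A [mA hA]|A hA].
- by split => //; rewrite setI0; exact: sigma_algebra0.
- split; first by rewrite setTD; exact: measurableC.
  have := sigma_algebraCD hA; congr (FT' _ _ _).
  by apply/seteqP; split => w /=; tauto.
- split; first by apply: bigcupT_measurable => k; have [] := hA k.
  by rewrite setI_bigcupr; apply: sigma_algebra_bigcup => k; have [] := hA k.
Qed.

Local Notation OmegaT := (g_sigma_algebraType FTfull).

Lemma FTfull_id : measurable_fun setT (id : Omega -> OmegaT).
Proof.
move=> _ B; rewrite measurable_g_measurableTypeE; last exact: FTfull_sigma.
by rewrite setTI => -[].
Qed.

Lemma FTfull_adapted Y : adapted_cadlag_real F Y ->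
  measurable_fun [set: OmegaT] (fun w => Y (fT w) w).
Proof.
move=> aY; apply/gsigma_measurable_fun; first exact: FTfull_sigma.
move=> B mB; split; last exact: (FT'_adapted aY mB).
by rewrite -[X in measurable X]setTI; exact: (measurable_adapted_fT aY).
Qed.

Lemma FTfull_fT : measurable_fun [set: OmegaT] fT.
Proof.
apply: (@FTfull_adapted (fun t _ => t)); split => [t t0 B mB|w].
  have [Bt|Bt] := pselect (B t).
    rewrite (_ : _ @^-1` _ = setT); last by apply/seteqP; split.
    exact: (filtration_setT hF t0).
  rewrite (_ : _ @^-1` _ = set0); last by apply/seteqP; split.
  by have [h _] := hF; have [] := h t t0.
exact: cadlagR_id.
Qed.

Context (P : probability Omega R) (n : nat) (X : R -> Omega -> 'rV[R]_n)
  (hX : levy P F X).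

(** For fixed s, the stopped path at s is the value at [T] of the process u -> X_{min(s,u)}, which
    is adapted and càdlàg in u. *)
Lemma FTfull_stopp :
  measurable_fun [set: OmegaT] (fun w => stopp (fT w) (Xpath X w)).
Proof.
apply: measurable_to_path => s i s0.
rewrite (_ : (fun _ => _) = fun w => X (Num.min s (fT w)) w ord0 i); last first.
  by apply/funext => w; rewrite (pval_stopp _ _ (fT_ge0 w)) (pval_Xpath hX).
apply: (@FTfull_adapted (fun u w => X (Num.min s u) w ord0 i)).
have m0 t : 0 <= t -> 0 <= Num.min s t by move=> t0; rewrite le_min s0.
split => [t t0 B mB|w].
  have [+ _] := hX; move=> /(_ _ (m0 _ t0) _ (borelRn_coord i mB)).
  by apply: (filtration_le hF (m0 _ t0)); rewrite ge_min lexx orbT.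
have [_ [cX _]] := hX.
apply: (@cadlagR_comp _ (fun u => X u w ord0 i) (fun u => Num.min s u)) => //.
- exact: cX.
- by move=> x y xy; rewrite le_min !ge_min lexx xy orbT.
- by move=> x; apply: cvg_minr; [exact: cvg_cst|exact: cvg_id].
Qed.

Lemma FTfull_constp :
  measurable_fun [set: OmegaT] (fun w => constp (pval (Xpath X w) (fT w))).
Proof.
apply: measurable_to_path => s i s0.
rewrite (_ : (fun _ => _) = fun w => X (fT w) w ord0 i); last first.
  by apply/funext => w; rewrite pval_constp (pval_Xpath hX).
apply: (@FTfull_adapted (fun u w => X u w ord0 i)).
have [aX [cX _]] := hX; split => [t t0 B mB|w]; last exact: cX.
exact: aX _ (borelRn_coord i mB).
Qed.

Definition DeltaT (w : Omega) := deltap (fT w) (Xpath X w).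

Lemma measurable_DeltaT : measurable_fun setT DeltaT.
Proof.
apply: measurable_deltap; [exact: measurable_fT|exact: fT_ge0|].
exact: measurable_Xpath hF hX.
Qed.

Lemma pval_DeltaT w : pval (DeltaT w) = Delta X T w.
Proof.
by apply/funext => s; rewrite (pval_deltap _ _ (fT_ge0 w)) (pval_Xpath hX).
Qed.

Context (Tp : (0 < P (Tfin T))%E).

(** Statement (ii) without the normalisation by P(T < oo): a single identity holds both the
    independence and, for G = [Tfin T], the law. *)
Definition fresh_increments :=
  forall G C, FT' F T G -> measurable C ->
    P (G `&` DeltaT @^-1` C) = (P G * levy_law hF hX C)%E.

Lemma fresh_FTfull : fresh_increments ->
  forall A B, (measurable : set (set OmegaT)) A -> measurable B ->
  P (Tfin T `&` id @^-1` A `&` DeltaT @^-1` B) =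
  (P (Tfin T `&` id @^-1` A) * levy_law hF hX B)%E.
Proof.
move=> hf A B; rewrite measurable_g_measurableTypeE; last exact: FTfull_sigma.
by move=> [_ FA] mB; exact: hf.
Qed.

Lemma prop_iiP : prop_ii P F X T <-> fresh_increments.
Proof.
have mTf := measurable_Tfin.
pose p := fine (P (Tfin T)).
have pE : P (Tfin T) = p%:E by rewrite /p fineK// fin_num_measure.
have p0 : p != 0 by apply/eqP => p0; move: Tp; rewrite pE p0 ltxx.
have condPM A : (condP P (Tfin T) A * p%:E)%E = P (Tfin T `&` A).
  rewrite /condP -/p -muleA -EFinM mulVf// mule1 //.
have lawE A C : (forall f : pathsp R n, A (pval f) <-> C f) -> law P X A = levy_law hF hX C.
  move=> AC; rewrite /law /levy_law /image_measure /pushforward; congr (P _).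
  apply/seteqP; split => w; rewrite /path /= => h.
    by apply/AC; rewrite (pval_Xpath hX).
  by move/AC : h; rewrite (pval_Xpath hX).
have AE A C : (forall f : pathsp R n, A (pval f) <-> C f) ->
    [set w | A (Delta X T w)] = DeltaT @^-1` C.
  move=> AC; apply/seteqP; split => w /=; rewrite -pval_DeltaT; first by move/AC.
  by move=> ?; apply/AC.
split => [[h1 h2] G C FG mC|h].
  have AC : forall f, (pval @` C) (pval f) <-> C f.
    by move=> f; split => [[g Cg /pval_inj <-]|Cf]; [|exists f].
  have DA := Dsigma_image mC.
  have := h1 _ _ DA FG; rewrite h2// (lawE _ _ AC) (AE _ _ AC).
  move=> e; have := condPM (DeltaT @^-1` C `&` G).
  rewrite e -muleA condPM (setIC (_ @^-1` _) G) !setIA (setIidr (FT'_sub FG)) => <-.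
  by rewrite muleC.
have H A G : Dsigma A -> FT' F T G ->
    condP P (Tfin T) ([set w | A (Delta X T w)] `&` G) =
    (condP P (Tfin T) G * law P X A)%E.
  move=> DA FG; have AC f : A (pval f) <-> (pval @^-1` A) f by [].
  rewrite (lawE _ _ AC) (AE _ _ AC) /condP.
  rewrite (setIC _ G) !setIA (setIidr (FT'_sub FG)) (h _ _ FG (Dsigma_pval DA)).
  by rewrite -!muleA; congr (_ * _)%E; rewrite muleC.
have cT : condP P (Tfin T) (Tfin T) = 1%E.
  by rewrite /condP setIid pE -EFinM /= divff.
have H2 A : Dsigma A -> condP P (Tfin T) [set w | A (Delta X T w)] = law P X A.
  move=> DA; rewrite -[RHS]mul1e -cT -H//; last exact: FT'_Tfin.
  by rewrite /condP setICA setIid setIC.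
by split => // A G DA FG; rewrite H// H2// muleC.
Qed.

End RandomTimeSigma.

(** * From stopping times to independent increments *)

Section LimitLaw.
Context {R : realType}.

Lemma bounded_cvg_integral d (T : measurableType d)
    (mu : {finite_measure set T -> \bar R}) (f_ : (T -> R)^nat) (f : T -> R) :
  (forall k, measurable_fun setT (f_ k)) -> measurable_fun setT f ->
  (forall k w, 0 <= f_ k w <= 1) -> (forall w, f_ ^~ w @ \oo --> f w) ->
  (\int[mu]_w (f_ k w)%:E)%E @[k --> \oo] --> (\int[mu]_w (f w)%:E)%E.
Proof.
move=> mf_ mf b cf.
have [] := @dominated_convergence _ _ _ mu setT measurableT
  (fun k w => (f_ k w)%:E) (EFin \o f) (cst 1%E) => //.
- by move=> k; exact/measurable_EFinP.
- exact/measurable_EFinP.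
- by apply: aeW => w _; apply/cvg_EFin; [exact: nearW|exact: cf].
- exact: finite_measure_integrable_cst.
- by apply: aeW => w k _; rewrite /= lee_fin ger0_norm; have /andP[] := b k w.
Qed.

Let ramp (m : nat) (x : R) : R := Num.min 1 (Num.max 0 (m%:R * x)).

Let ramp_measurable d (T : measurableType d) m (Y : T -> R) :
  measurable_fun setT Y -> measurable_fun setT (fun w => ramp m (Y w)).
Proof.
move=> mY; apply: measurable_minr => //; apply: measurable_maxr => //.
by apply: measurable_funM.
Qed.

Let ramp_bound m x : 0 <= ramp m x <= 1.
Proof. by rewrite /ramp le_min ge_min !lexx ler01 le_max lexx. Qed.

Let ramp_cvg x : ramp ^~ x @ \oo --> ((0 < x)%R%:R : R).
Proof.
have [x0|x0] := ltP 0 x; last first.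
  rewrite (_ : ramp ^~ x = cst 0); first exact: cvg_cst.
  apply/funext => m; rewrite /ramp max_l ?mulr_ge0_le0//.
  by rewrite min_r.
apply: cvg_near_cst; near=> m; apply: min_l; rewrite le_max -ler_pdivrMr// div1r.
apply/orP; right; near: m; exact: nbhs_infty_ger.
Unshelve. all: by end_near. Qed.

(* Weak convergence, with the bounded continuous functions [ramp m], which
   increase to the indicator of the positive reals. *)
Lemma limit_law d1 d2 (T1 : measurableType d1) (T2 : measurableType d2)
    (mu : {finite_measure set T1 -> \bar R})
    (nu : {finite_measure set T2 -> \bar R})
    (Y_ : (T1 -> R)^nat) (Y : T1 -> R) (M : T2 -> R) :
  (forall k, measurable_fun setT (Y_ k)) -> measurable_fun setT Y ->
  measurable_fun setT M -> (forall w, Y_ ^~ w @ \oo --> Y w) ->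
  (forall k B, measurable B -> mu (Y_ k @^-1` B) = nu (M @^-1` B)) ->
  mu [set w | 0 < Y w] = nu [set w | 0 < M w].
Proof.
move=> mY_ mY mM cY law.
have rampE m : (\int[mu]_w (ramp m (Y w))%:E = \int[nu]_w (ramp m (M w))%:E)%E.
  have h k : (\int[mu]_w (ramp m (Y_ k w))%:E = \int[nu]_w (ramp m (M w))%:E)%E.
    have mr : measurable_fun [set: R] (EFin \o ramp m).
      by apply/measurable_EFinP; apply: ramp_measurable; exact: measurable_id.
    have r0 : {in [set: R], forall y : R, 0 <= (EFin \o ramp m) y}%E.
      by move=> y _; rewrite lee_fin; have /andP[] := ramp_bound m y.
    have := ge0_integral_pushforward (mY_ k) mu measurableT mr r0.
    have := ge0_integral_pushforward mM nu measurableT mr r0.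
    rewrite !preimage_setT /comp => <- <-.
    by apply: eq_measure_integral => B mB _; exact: law.
  have : (\int[mu]_w (ramp m (Y_ k w))%:E)%E @[k --> \oo] -->
         (\int[mu]_w (ramp m (Y w))%:E)%E.
    apply: bounded_cvg_integral => [k||k w|w].
    - exact: ramp_measurable.
    - exact: ramp_measurable.
    - exact: ramp_bound.
    - apply: cvg_minr; first exact: cvg_cst.
      apply: cvg_maxr; first exact: cvg_cst.
      by apply: cvgMr; exact: cY.
  (* The converging sequence is constant by [h], so its limit is that constant. *)
  under eq_cvg do rewrite h.
  by move=> /(cvg_unique (@ereal_hausdorff R) (@cvg_cst _ _ _ _ _)).
have lim d (T : measurableType d) (m : {finite_measure set T -> \bar R})
    (Z : T -> R) : measurable_fun setT Z ->
    (\int[m]_w (ramp k (Z w))%:E)%E @[k --> \oo] --> m [set w | 0 < Z w].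
  move=> mZ.
  have mpos : measurable [set w | 0 < Z w].
    have := mZ measurableT `]0, +oo[%classic (measurable_itv _).
    by rewrite setTI; congr measurable; apply/seteqP; split => w /=;
      rewrite in_itv/= andbT.
  rewrite -[X in m X]setIT -integral_indic//.
  apply: bounded_cvg_integral => // [k|w]; first exact: ramp_measurable.
  rewrite indicE (_ : (w \in _) = (0 < Z w)); first exact: ramp_cvg.
  by apply/idP/idP; rewrite inE.
have := lim _ _ mu Y mY; under eq_cvg do rewrite rampE.
by move=> /(cvg_unique (@ereal_hausdorff R)); apply; exact: lim.
Qed.

End LimitLaw.

Section StrongMarkov.
Context {R : realType} d (Omega : measurableType d)
  (F : R -> set (set Omega)) (T : Omega -> \bar R)
  (hF : filtration F) (mT : measurable_fun setT T) (T0 : forall w, (0 <= T w)%E)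
  (P : probability Omega R) (n : nat) (X : R -> Omega -> 'rV[R]_n)
  (hX : levy P F X) (sT : prop_iii P F T).
Local Notation Fb := (completed_filtration P F).

Lemma levy_indep_completed s A C : 0 <= s -> Fb s A -> measurable C ->
  P (A `&` (fun w => deltap s (Xpath X w)) @^-1` C) =
  (P A * levy_law hF hX C)%E.
Proof.
move=> s0 FA mC.
have [mA [A' FA' AA']] := completion_ae (filtration_sigma hF s0)
  (fun A => filtration_measurable hF s0) FA.
have mA' := filtration_measurable hF s0 FA'.
have mD : measurable ((fun w => deltap s (Xpath X w)) @^-1` C).
  by rewrite -[X in measurable X]setTI; exact: (measurable_delta_Xpath hF hX).
rewrite (ae_iff_measure mA mA' AA') -(levy_indep hF hX s0 FA' mC).
apply: ae_iff_measure; [exact: measurableI|exact: measurableI|].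
by apply: filterS AA' => w h; split => -[/h].
Qed.

Lemma Fb_le s t A : 0 <= s -> s <= t -> Fb s A -> Fb t A.
Proof.
by move=> s0 st; apply: completion_sub => B; exact: (filtration_le hF s0 st).
Qed.

Lemma Fb_lt t : 0 <= t -> Fb t [set w | (T w < t%:E)%E].
Proof.
(* The stopping property is stated for nonnegative times only; when t - 1/(m+1) < 0 the empty set
   takes over, [T] being nonnegative. *)
move=> t0; rewrite (_ : mkset _ = \bigcup_m
    (if 0 <= t - m.+1%:R^-1 then [set w | (T w <= (t - m.+1%:R^-1)%:E)%E] else set0)).
  apply: sigma_algebra_bigcup => m; case: ifPn => h; last exact: sigma_algebra0.
  apply: (@Fb_le (t - m.+1%:R^-1)) => //; first by rewrite gerBl.
  exact: sT.
apply/seteqP; split => w /=.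
  move=> Tt; have Tw : Tfin T w by exact: lt_trans Tt (ltry _).
  have := Tt; rewrite (TfinE T0 Tw) lte_fin => /ltr_add_invr[m hm].
  have h : fT T w <= t - m.+1%:R^-1 by rewrite lerBrDr ltW.
  exists m => //; rewrite (le_trans (fT_ge0 T0 w) h) /=.
  by rewrite (TfinE T0 Tw) lee_fin.
move=> [m _]; case: ifPn => // _ /= /le_lt_trans; apply.
by rewrite lte_fin gtrBl invr_gt0.
Qed.

(** This makes the part of [G] in a half-open grid cell an event of the past at the right end of the
    cell. *)
Lemma FT'_before G t : FT' F T G -> 0 <= t -> Fb t (G `&` [set w | (T w < t%:E)%E]).
Proof.
move=> FG; move: t; suff : [set A | A `<=` Tfin T /\
   forall t, 0 <= t -> Fb t (A `&` [set w | (T w < t%:E)%E])] G by case.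
move: G FG; apply: FT'_min => //.
  split => [|A [AT hA]|A hA].
  - by split => // t t0; rewrite set0I; exact: sigma_algebra0.
  - split => [w []//|t t0].
    rewrite (_ : _ `&` _ = [set w | (T w < t%:E)%E] `\` (A `&` [set w | (T w < t%:E)%E])).
      apply: (@measurableD _ (g_sigma_algebraType (F t `|` Pnull P))).
        exact: Fb_lt.
      exact: hA.
    apply/seteqP; split => w /= [].
      by move=> [_ Aw] Tt; split => // -[].
    move=> Tt Aw; split => //; split; first exact: lt_trans Tt (ltry _).
    by move=> ?; apply: Aw.
  - split => [w [k _]|t t0]; first by have [h _] := hA k; exact: h.
    rewrite setI_bigcupl; apply: sigma_algebra_bigcup => k.
    by have [_ h] := hA k; exact: h.
move=> Y B aY mB; split => [w []//|t t0].
pose Ft := g_sigma_algebraType (F t `|` Pnull P).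
(* [tau] agrees with [T] where T < t and is t elsewhere, which makes it measurable at time t.
   Reading [Y] at min(s, t) keeps every value of the process measurable at time t as well, so
   [measurable_random_time] applies on [Ft]. *)
pose tau w := if (T w < t%:E)%E then fT T w else t.
have tau0 w : 0 <= tau w by rewrite /tau; case: ifP => // _; exact: fT_ge0.
have mtau : measurable_fun [set: Ft] tau.
  apply: (measurability _ (RGenInftyO.measurableE R)).
  move=> _ [_ [x ->] <-]; rewrite setTI.
  have [xt|tx] := leP x t; last first.
    rewrite (_ : _ @^-1` _ = setT) //; apply/seteqP; split => w // _ /=.
    rewrite in_itv/= (le_lt_trans _ tx)// /tau; case: ifPn => // Tt.
    by rewrite -lee_fin -(TfinE T0) 1?ltW//; exact: lt_trans Tt (ltry _).
  have [x0|x0] := leP 0 x.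
    suff : Fb t [set w | (T w < x%:E)%E].
      congr (Fb t _); apply/seteqP; split => w /=; rewrite in_itv/= /tau.
        move=> Tx; have Tt : (T w < t%:E)%E by apply: lt_le_trans Tx _; rewrite lee_fin.
        by rewrite Tt -lte_fin -(TfinE T0)//; exact: lt_trans Tt (ltry _).
      case: ifPn => [Tt|_]; last by rewrite ltNge xt.
      by rewrite -lte_fin -(TfinE T0)//; exact: lt_trans Tt (ltry _).
    by apply: (Fb_le x0 xt); exact: Fb_lt.
  rewrite (_ : _ @^-1` _ = set0); first exact: measurable0.
  apply/seteqP; split => w //=; rewrite in_itv/= => h.
  by have := le_lt_trans (tau0 w) (lt_trans h x0); rewrite ltxx.
have mint s : 0 <= s -> 0 <= Num.min s t by move=> s0; rewrite le_min s0.
have mY : measurable_fun [set: Ft] (fun w => Y (Num.min (tau w) t) w).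
  apply: (@measurable_random_time _ _ Ft (fun s w => Y (Num.min s t) w) tau) => //.
    move=> s s0 _ C mC; rewrite setTI; apply: sub_sigma_algebra; left.
    have [aYm _] := aY.
    apply: (filtration_le hF (mint _ s0)); last exact: aYm (mint _ s0) _ mC.
    by rewrite ge_min lexx orbT.
  move=> w; have [_ cY] := aY; apply: (@cadlagR_comp _ (Y ^~ w) (fun s => Num.min s t)) => //.
  - by move=> x y xy; rewrite le_min !ge_min xy lexx orbT.
  - by move=> x; apply: cvg_minr; [exact: cvg_id|exact: cvg_cst].
rewrite (_ : _ `&` _ = (fun w => Y (Num.min (tau w) t) w) @^-1` B `&`
   [set w | (T w < t%:E)%E]).
  apply: (@measurableI _ Ft); last exact: Fb_lt.
  by rewrite -[X in measurable X]setTI; exact: mY.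
have e w : (T w < t%:E)%E -> Num.min (tau w) t = fT T w.
  move=> Tt; rewrite /tau Tt min_l//.
  by rewrite -lee_fin -(TfinE T0) 1?ltW//; exact: lt_trans Tt (ltry _).
apply/seteqP; split => w /= [].
  by move=> [_ h] Tt; split => //; rewrite e.
move=> h Tt; split => //; split; first exact: lt_trans Tt (ltry _).
by move: h; rewrite e.
Qed.

Lemma gridup_fresh G C k : FT' F T G -> measurable C ->
  P (G `&` (fun w => deltap (gridup k (fT T w)) (Xpath X w)) @^-1` C) =
  (P G * levy_law hF hX C)%E.
Proof.
move=> FG mC; have GT := FT'_sub FG.
pose t j : R := j%:R / k.+1%:R.
have t0 j : 0 <= t j by rewrite divr_ge0.
have tlt j : t j <= t j.+1 by rewrite ler_pM2r ?invr_gt0// ler_nat.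
(* The cell [t j] <= T < [t j.+1] of [G], on which [gridup k] equals the right end [t j.+1]; by that
   time the cell is decided. *)
pose Gj j := (G `&` [set w | (T w < (t j.+1)%:E)%E]) `\`
             (G `&` [set w | (T w < (t j)%:E)%E]).
have FGj j : Fb (t j.+1) (Gj j).
  apply: (@measurableD _ (g_sigma_algebraType (F (t j.+1) `|` Pnull P))).
    exact: (FT'_before FG (t0 _)).
  exact: (Fb_le (t0 j) (tlt j) (FT'_before FG (t0 _))).
have GjP j w : Gj j w <-> G w /\ Num.truncn (k.+1%:R * fT T w) = j.
  have tr : G w -> (t j <= fT T w < t j.+1) = (Num.truncn (k.+1%:R * fT T w) == j).
    move=> Gw; rewrite truncn_eq ?mulr_ge0 ?fT_ge0//.
    by rewrite ler_pdivrMr// ltr_pdivlMr// mulrC.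
  split => [[[Gw /=]]|[Gw /eqP]].
    rewrite (TfinE T0 (GT _ Gw)) lte_fin => h1 h2; split => //; apply/eqP.
    rewrite -tr// h1 andbT leNgt; apply/negP => h3; apply: h2; split => //=.
  rewrite -tr// => /andP[h1 h2]; split.
    by split => //=; rewrite (TfinE T0 (GT _ Gw)) lte_fin.
  by move=> [_ /=]; rewrite (TfinE T0 (GT _ Gw)) lte_fin ltNge h1.
have mGj j : measurable (Gj j).
  have [] := completion_ae (filtration_sigma hF (t0 j.+1))
    (fun A => filtration_measurable hF (t0 j.+1)) (FGj j) => //.
have GE : G = \bigcup_j Gj j.
  apply/seteqP; split => w; last by move=> [j _ /GjP[]].
  by move=> Gw; exists (Num.truncn (k.+1%:R * fT T w)) => //; exact/GjP.
have tG (D : set Omega) : trivIset setT (fun j => Gj j `&` D).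
  apply/trivIsetP => i j _ _ ij; apply/seteqP; split => w //.
  by move=> [[/GjP[_ ei] _] [/GjP[_ ej] _]]; move: ij; rewrite -ei -ej eqxx.
have mD j : measurable ((fun w => deltap (t j) (Xpath X w)) @^-1` C).
  by rewrite -[X in measurable X]setTI; exact: (measurable_delta_Xpath hF hX).
rewrite (_ : _ `&` _ = \bigcup_j
    (Gj j `&` (fun w => deltap (t j.+1) (Xpath X w)) @^-1` C)); last first.
  apply/seteqP; split => [w [Gw /= h]|w [j _ [/GjP[Gw e] /= h]]].
    by exists (Num.truncn (k.+1%:R * fT T w)) => //; split => //; exact/GjP.
  split; first exact: Gw.
  have de : gridup k (fT T w) = t j.+1 by rewrite /gridup e.
  by rewrite /= de.
have LE : levy_law hF hX C = (fine (levy_law hF hX C))%:E.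
  by rewrite fineK// fin_num_measure.
rewrite measure_bigcup//; last 2 first.
- by move=> j _; exact: measurableI.
- apply/trivIsetP => i j _ _ ij; apply/seteqP; split => w //.
  by move=> [[/GjP[_ ei] _] [/GjP[_ ej] _]]; move: ij; rewrite -ei -ej eqxx.
rewrite (eq_eseriesr (g := fun j => ((fine (levy_law hF hX C))%:E * P (Gj j))%E)); last first.
  by move=> j _; rewrite [RHS]muleC -LE; exact: (levy_indep_completed (t0 _) (FGj j) mC).
rewrite nneseriesZl//.
rewrite -measure_bigcup//; last first.
  by have := tG setT; under eq_fun do rewrite setIT.
by rewrite -GE -LE muleC.
Qed.

(** The least slack among the strict bounds of a cylinder, so that the cylinder is {margin > 0}; the
    start value 1 only has to be positive. As a minimum over finitely many coordinates it converges
    along [gridup k r] by right continuity. *)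
Let margin (l : seq (R * 'I_n * R)) (p : pathsp R n) : R :=
  foldr (fun x m => Num.min (pval p x.1.1 ord0 x.1.2 - x.2) m) 1 l.

Let marginP l p : cyl l p <-> 0 < margin l p.
Proof.
elim: l => [|x l IH]; first by split.
by rewrite cyl_cons /= lt_min subr_gt0; split => [[h /IH ->]|/andP[h /IH]];
  [rewrite andbT|].
Qed.

Let margin_measurable l : times_ge0 l -> measurable_fun setT (margin l).
Proof.
elim: l => [_|x l IH /andP[x0 /IH ml]] /=; first exact: measurable_cst.
apply: measurable_minr => //; apply: measurable_funB => //.
exact: measurable_pval.
Qed.

Let margin_cvg l r p : times_ge0 l -> 0 <= r ->
  margin l (deltap (gridup k r) p) @[k --> \oo] --> margin l (deltap r p).
Proof.
move=> + r0; elim: l => [_|x l IH /andP[x0 /IH ml]] /=; first exact: cvg_cst.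
apply: cvg_minr => //; apply: cvgB; last exact: cvg_cst.
have d0 k : 0 <= gridup k r by exact/ltW/(le_lt_trans r0)/gridup_gt.
under eq_fun do rewrite (pval_deltap _ _ (d0 _)) !mxE.
rewrite (pval_deltap _ _ r0) !mxE.
apply: cvgB.
  exact: (@cvg_gridup _ (fun t => pval p t ord0 x.1.2) r x.1.1 r0 (cadlag_pval p _) x0).
have := @cvg_gridup _ (fun t => pval p t ord0 x.1.2) r 0 r0 (cadlag_pval p _) (lexx 0).
by under eq_fun do rewrite addr0; rewrite addr0.
Qed.

(** Indicators of cylinders need not converge along the approximating times, but margins do, and by
    [gridup_fresh] their law on [G] is the same for every k; [limit_law] then gives the
    cylinders. *)
Lemma strong_markov : fresh_increments T hF hX.
Proof.
move=> G C FG mC; have mG := FT'_measurable hF mT T0 FG.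
have mD := measurable_DeltaT hF mT T0 hX.
have PG0 : 0 <= fine (P G) by rewrite fine_ge0.
have PGE : (fine (P G))%:E = P G by rewrite fineK// fin_num_measure.
pose mu : {finite_measure set Omega -> \bar R} := mrestr P mG.
pose m1 : {finite_measure set (pathsp R n) -> \bar R} := image_measure mu mD.
pose m2 : {finite_measure set (pathsp R n) -> \bar R} :=
  mscale (NngNum PG0) (levy_law hF hX).
have muE A : mu A = P (G `&` A) by rewrite /mu /= /mrestr setIC.
have m1E A : m1 A = mu (DeltaT T X @^-1` A) by [].
have m2E A : m2 A = (P G * levy_law hF hX A)%E by rewrite /m2 /= /mscale /= PGE.
clearbody m1 m2 mu.
suff /(_ C mC) : forall C, measurable C -> m1 C = m2 C by rewrite m1E muE m2E.
apply: eq_on_cylinders; first by rewrite -ge0_fin_numE// fin_num_measure.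
move=> l l0.
have cE (m : set (pathsp R n) -> \bar R) : m (cyl l) = m [set p | 0 < margin l p].
  by congr m; apply/seteqP; split => p /marginP.
rewrite cE [RHS]cE.
transitivity (mu [set w | 0 < margin l (DeltaT T X w)]); first exact: m1E.
have d0 k w : 0 <= gridup k (fT T w).
  exact/ltW/(le_lt_trans (fT_ge0 T0 w))/gridup_gt.
have mdy k : measurable_fun setT (fun w => deltap (gridup k (fT T w)) (Xpath X w)).
  apply: measurable_deltap => //; last exact: (measurable_Xpath hF hX).
  apply: (measurableT_comp _ (measurable_fT mT)).
  apply: nondecreasing_measurable => // x y xy; rewrite ler_pM2r ?invr_gt0//.
  by rewrite ler_nat ltnS; apply: le_truncn; rewrite ler_pM2l.
apply: (@limit_law _ _ _ _ _ mu m2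
  (fun k w => margin l (deltap (gridup k (fT T w)) (Xpath X w)))).
- by move=> k; exact: (measurableT_comp (margin_measurable l0) (mdy k)).
- exact: (measurableT_comp (margin_measurable l0) mD).
- exact: margin_measurable.
- by move=> w; apply: margin_cvg => //; exact: fT_ge0.
- move=> k B mB; have mM : measurable (margin l @^-1` B).
    by rewrite -[X in measurable X]setTI; exact: margin_measurable.
  have := gridup_fresh k FG mM; rewrite -muE => e.
  by apply: (etrans e); rewrite -m2E.
Qed.

End StrongMarkov.

(** * Equivalence of (i) and (ii) *)

Section SectionMeasure.
Context {R : realType} d1 d2 (T1 : measurableType d1) (T2 : measurableType d2)
  (L : probability T2 R).

Lemma measurable_section (S : set (T1 * T2)) x :
  measurable S -> measurable [set y | S (x, y)].
Proof.
move=> /(measurable_xsection x); congr measurable.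
by apply/seteqP; split => y; rewrite /xsection/= inE.
Qed.

Lemma measurable_section_measure (S : set (T1 * T2)) :
  measurable S -> measurable_fun setT (fun x => L [set y | S (x, y)]).
Proof.
move=> /(measurable_fun_xsection L); apply: eq_measurable_fun => x _ /=.
by congr (L _); apply/seteqP; split => y; rewrite /xsection/= inE.
Qed.

End SectionMeasure.

Section FreezingSets.
Local Open Scope ereal_scope.
Context {R : realType} d (T : measurableType d)
  d1 d2 (T1 : measurableType d1) (T2 : measurableType d2)
  (mu : {finite_measure set T -> \bar R}) (D : set T) (L : probability T2 R)
  (a : T -> T1) (b : T -> T2).

Lemma freezing_set (S : set (T1 * T2)) :
  measurable D -> measurable_fun setT a -> measurable_fun setT b ->
  (forall A B, measurable A -> measurable B ->
    mu (D `&` a @^-1` A `&` b @^-1` B) = mu (D `&` a @^-1` A) * L B) ->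
  measurable S ->
  mu (D `&` [set w | S (a w, b w)]) =
  \int[mu]_(w in D) L [set y | S (a w, y)].
Proof.
move=> mD ma mb ind mS.
have mab : measurable_fun setT (fun w => (a w, b w)) by exact: measurable_fun_pair.
have mSab : measurable [set w | S (a w, b w)].
  by rewrite -[X in measurable X]setTI; exact: (mab measurableT S mS).
rewrite setIC -integral_indic//.
have := @freezing _ _ _ _ _ _ _ _ _ L _ _ (fun x y => (\1_S (x, y))%:E)
  mD ma mb ind _ (fun x y => _).
move=> /(_ _ _)/[dup] h _; transitivity (\int[mu]_(w in D) (\1_S (a w, b w))%:E).
  by apply: eq_integral => w _; rewrite !indicE; congr ((_ : bool)%:R%:E);
     apply/idP/idP; rewrite !inE.
rewrite h.
- apply: eq_integral => w _.
  have mSw := measurable_section (a w) mS.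
  by rewrite -[X in L X]setIT -integral_indic.
- apply/measurable_EFinP; rewrite (_ : (fun _ => _) = \1_S).
    exact: measurable_indic.
  by apply/funext => -[].
- by move=> x y; rewrite lee_fin.
Qed.

End FreezingSets.

Section PathAlgebra.
Context {R : realType} {n : nat}.
Local Notation E := (pathsp R n).

Lemma catp_stop r (p : E) : 0 <= r -> catp (stopp r p) r (deltap r p) = p.
Proof.
move=> r0; apply: pval_inj; apply/funext => s.
rewrite pval_catp (pval_stopp _ _ r0) (pval_deltap _ _ r0).
have [rs|sr] := leP r s.
  rewrite max_l ?subr_ge0// addrCA subrr addr0 addrC subrK //.
by rewrite max_r ?subr_le0 1?ltW// addr0 subrr addr0.
Qed.

Lemma deltap_deltap r t (p : E) : 0 <= r -> r <= t ->
  deltap (t - r) (deltap r p) = deltap t p.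
Proof.
move=> r0 rt; have tr : 0 <= t - r by rewrite subr_ge0.
apply: pval_inj; apply/funext => s.
apply: (etrans (pval_deltap (deltap r p) s tr)).
apply: (etrans _ (esym (pval_deltap p s (le_trans r0 rt)))).
rewrite !(pval_deltap p _ r0).
by rewrite addrA (addrC r (t - r)) subrK opprB addrA subrK.
Qed.

Lemma deltap0_addp_constp x (p : E) :
  deltap 0 (addp (constp x) p) = deltap 0 p.
Proof.
apply: pval_inj; apply/funext => s.
apply: (etrans (pval_deltap _ s (lexx 0))).
apply: (etrans _ (esym (pval_deltap p s (lexx 0)))).
by rewrite !pval_addp !pval_constp opprD addrACA subrr add0r.
Qed.

End PathAlgebra.

Section MarkovEquivalence.
Context {R : realType} d (Omega : measurableType d)
  (F : R -> set (set Omega)) (T : Omega -> \bar R)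
  (hF : filtration F) (mT : measurable_fun setT T) (T0 : forall w, (0 <= T w)%E)
  (P : probability Omega R) (n : nat) (X : R -> Omega -> 'rV[R]_n)
  (hX : levy P F X) (Tp : (0 < P (Tfin T))%E).
Local Notation E := (pathsp R n).
Local Notation OmegaT := (g_sigma_algebraType (FTfull F T)).
Local Notation X0T w := (constp (pval (Xpath X w) (fT T w)) : E).
Local Notation L := (levy_law hF hX).

Lemma theta_addp w : theta X T w = pval (addp (X0T w) (DeltaT T X w)).
Proof.
apply/funext => s; rewrite pval_addp pval_constp (pval_DeltaT T0 hX).
by rewrite (pval_Xpath hX) /theta /Delta /= [RHS]addrC subrK.
Qed.

Lemma FTfull_meas_nonneg (W : Omega -> \bar R) : (forall w, 0 <= W w)%E ->
  measurable_fun [set: OmegaT] W -> FT'_meas_nonneg F T W.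
Proof.
move=> W0 /(gsigma_measurable_fun _ (FTfull_sigma F T)) mW.
by split => // B mB; have [] := mW B mB.
Qed.

Lemma Pker_levy_law x (H : (R -> 'rV[R]_n) -> \bar R) :
  Dmeas_nonneg H ->
  Pker P X x H = (\int[L]_f H (pval (addp (constp x) f)))%E.
Proof.
move=> /Dmeas_nonnegP[H0 mH].
have mA : measurable_fun [set: E] (fun f => addp (constp x) f).
  by apply: measurable_addp => //; exact: measurable_cst.
have := ge0_integral_pushforward (measurable_Xpath hF hX) P measurableT
  (measurableT_comp mH mA) (fun f _ => H0 (addp (constp x) f)).
rewrite preimage_setT => h; rewrite [RHS]h /Pker; apply: eq_integral => w _ /=.
congr H; apply/funext => t.
by rewrite pval_addp pval_constp (pval_Xpath hX).
Qed.

Lemma condE_inj (f g : Omega -> \bar R) :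
  condE P (Tfin T) f = condE P (Tfin T) g ->
  (\int[P]_(w in Tfin T) f w = \int[P]_(w in Tfin T) g w)%E.
Proof.
have pE : (fine (P (Tfin T)))%:E = P (Tfin T).
  by rewrite fineK// fin_num_measure//; exact: measurable_Tfin.
have p0 : fine (P (Tfin T)) != 0.
  by apply/eqP => p0; move: Tp; rewrite -pE p0 ltxx.
move=> /(congr1 (fun x => x * (fine (P (Tfin T)))%:E)%E).
by rewrite /condE -!muleA -!EFinM !mulVf// !mule1.
Qed.

Lemma prop_i_fresh : prop_i P F X T -> fresh_increments T hF hX.
Proof.
move=> hi G C FG mC.
have mG := FT'_measurable hF mT T0 FG.
have mTf := measurable_Tfin mT.
have GTf : Tfin T `&` G = G by rewrite setIidr//; exact: FT'_sub FG.
pose H (f : R -> 'rV[R]_n) : \bar R := (\1_C (deltap 0 (mkpath f)) : R)%:E.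
have DH : Dmeas_nonneg H.
  apply/Dmeas_nonnegP; split => [p|]; first by rewrite lee_fin.
  apply/measurable_EFinP => /=.
  rewrite (_ : (fun _ => _) = (\1_C : E -> R) \o (fun p : E => deltap 0 p)).
    apply: measurableT_comp; first exact: measurable_indic.
    by apply: (@measurable_deltap _ _ _ _ (fun=> 0)) => //; exact: measurable_cst.
  by apply/funext => p /=; rewrite pvalK.
have mW : FT'_meas_nonneg F T (fun w => (\1_G w : R)%:E).
  apply: FTfull_meas_nonneg => [w|]; first by rewrite lee_fin.
  apply/measurable_EFinP; apply: measurable_indic.
  by rewrite measurable_g_measurableTypeE; [split; rewrite ?GTf|exact: FTfull_sigma].
have := condE_inj (hi H _ DH mW).
(* The translation by x cancels in f - f(0), so the kernel is constant in x; [levy_delta0] removes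
   the remaining [deltap 0]. *)
have KE x : Pker P X x H = L C.
  rewrite (Pker_levy_law _ DH) /H.
  under eq_integral do rewrite pvalK deltap0_addp_constp.
  have m0 : measurable_fun setT (fun f : E => deltap 0 f).
    by apply: (@measurable_deltap _ _ _ _ (fun=> 0)) => //; exact: measurable_cst.
  have mC0 : measurable ((fun f : E => deltap 0 f) @^-1` C).
    by rewrite -[X in measurable X]setTI; exact: m0.
  transitivity (L ((fun f : E => deltap 0 f) @^-1` C)); last exact: (levy_delta0 hF hX mC).
  by rewrite -[X in L X]setIT -integral_indic.
have mD : measurable (DeltaT T X @^-1` C).
  by rewrite -[X in measurable X]setTI; exact: (measurable_DeltaT hF mT T0 hX).
have -> : (\int[P]_(w in Tfin T) (H (theta X T w) * (\1_G w)%:E) =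
    \int[P]_(w in Tfin T) (\1_(G `&` DeltaT T X @^-1` C) w)%:E)%E.
  apply: eq_integral => w _; rewrite theta_addp /H pvalK deltap0_addp_constp.
  have := deltap_deltap (Xpath X w) (fT_ge0 T0 w) (lexx _); rewrite subrr => ->.
  by rewrite setIC indicI EFinM.
rewrite integral_indic//; last exact: measurableI.
rewrite setIC setIA GTf => ->.
under eq_integral do rewrite KE.
rewrite ge0_integralZl//; last first.
  by apply/measurable_EFinP; apply: measurable_funTS; exact: measurable_indic.
by rewrite integral_indic// setIC GTf muleC.
Qed.

Lemma fresh_prop_i : fresh_increments T hF hX -> prop_i P F X T.
Proof.
move=> hf H W DH [W0 mW]; rewrite /condE; congr (_ * _)%E.
have mTf := measurable_Tfin mT.
have sTf := FTfull_sigma F T.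
have /Dmeas_nonnegP[H0 mH] := DH.
(* [W] is controlled on [Tfin T] only. Its extension by 0 is nonnegative and measurable on the whole
   space, as freezing requires: off [Tfin T] a preimage is all or nothing, according to whether the
   set contains 0. *)
pose W1 := W \_ (Tfin T).
have W10 w : (0 <= W1 w)%E.
  by rewrite /W1 patchE; case: ifPn => //; rewrite inE; exact: W0.
have mW1 : measurable_fun [set: OmegaT] W1.
  apply/(gsigma_measurable_fun _ sTf) => B mB.
  have TW : Tfin T `&` W1 @^-1` B = Tfin T `&` W @^-1` B.
    by apply/seteqP; split => w [Tw /=]; rewrite /W1 patchE mem_set.
  split; last by rewrite TW; exact: mW.
  rewrite -[X in measurable X]setIT -(setUv (Tfin T)) setIUr !(setIC (W1 @^-1` B)) TW.
  apply: measurableU; first exact: (FT'_measurable hF mT T0 (mW B mB)).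
  have [B0|B0] := pselect (B 0%E).
    rewrite setIidl; first exact: measurableC.
    by move=> w Tw; rewrite /= /W1 patchE memNset.
  rewrite (_ : _ `&` _ = set0)//; apply/seteqP; split => w // [Tw].
  by rewrite /= /W1 patchE memNset.
have id_ : measurable_fun setT (id : Omega -> OmegaT) := @FTfull_id _ _ _ F T.
have mc := FTfull_constp hF mT T0 hX.
(* With w frozen in [OmegaT], both X_T and the weight are constants and only the path of increments
   is integrated. *)
pose h (w : OmegaT) (f : E) : \bar R := (H (pval (addp (X0T w) f)) * W1 w)%E.
have h0 w f : (0 <= h w f)%E by apply: mule_ge0.
have mHa : measurable_fun [set: OmegaT * E] (fun z => H (pval (addp (X0T z.1) z.2))).
  apply: (measurableT_comp mH).
  apply: measurable_addp; first exact: measurable_snd.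
  exact: (measurableT_comp mc measurable_fst).
have mh : measurable_fun [set: OmegaT * E] (fun z => h z.1 z.2).
  by apply: emeasurable_funM => //; exact: (measurableT_comp mW1 measurable_fst).
have := freezing mTf id_ (measurable_DeltaT hF mT T0 hX)
  (fresh_FTfull hf) mh h0.
rewrite /h => e; transitivity
    (\int[P]_(w in Tfin T) (H (pval (addp (X0T w) (DeltaT T X w))) * W1 w))%E.
  apply: eq_integral => w; rewrite inE => Tw; rewrite theta_addp.
  by rewrite /W1 patchE mem_set.
apply: (etrans e); apply: eq_integral => w; rewrite inE => Tw.
have mHw : measurable_fun [set: E] (fun f => H (pval (addp (X0T w) f))).
  apply: (measurableT_comp mH).
  by apply: measurable_addp => //; exact: measurable_cst.
apply: (etrans (@ge0_integralZr _ _ _ L _ measurableT _ mHw _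
  (fun f _ => H0 _) (W10 w))).
have -> : W1 w = W w by rewrite /W1 patchE mem_set.
by rewrite (Pker_levy_law _ DH) /X_at (pval_Xpath hX).
Qed.

End MarkovEquivalence.

(** * From independent increments to stopping times *)

Section Converse.
Context {R : realType} d (Omega : measurableType d)
  (F : R -> set (set Omega)) (T : Omega -> \bar R)
  (hF : filtration F) (mT : measurable_fun setT T) (T0 : forall w, (0 <= T w)%E)
  (P : probability Omega R) (n : nat) (X : R -> Omega -> 'rV[R]_n)
  (hX : levy P F X).
Local Notation E := (pathsp R n).
Local Notation OmegaT := (g_sigma_algebraType (FTfull F T)).
Local Notation L := (levy_law hF hX).

Lemma sigmaX_Xpath A : sigmaX X A ->
  exists2 C : set E, measurable C & A = Xpath X @^-1` C.
Proof.
have sub : sigmaX X `<=` preimage_set_system setT (Xpath X) (@measurable _ E).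
  apply: smallest_sub.
    by apply: sigma_algebra_preimage; exact: sigma_algebra_measurable.
  move=> _ [t [i [B [t0 [mB ->]]]]].
  exists ((fun p : E => pval p t ord0 i) @^-1` B).
    by rewrite -[X in measurable X]setTI; exact: measurable_pval.
  by rewrite setTI; apply/seteqP; split => w; rewrite /= (pval_Xpath hX).
by move=> /sub[C mC <-]; exists C => //; rewrite setTI.
Qed.

Lemma filtration_path t (g : Omega -> E) :
  0 <= t -> (forall s i, 0 <= s ->
    measurable_fun [set: g_sigma_algebraType (F t)] (fun w => pval (g w) s ord0 i)) ->
  forall C, measurable C -> F t (g @^-1` C).
Proof.
move=> t0 mg; apply/(gsigma_measurable_fun _ (filtration_sigma hF t0)).
exact: measurable_to_path.
Qed.

Lemma filtration_stopp t C : 0 <= t -> measurable C ->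
  F t ((fun w => stopp t (Xpath X w) : E) @^-1` C).
Proof.
move=> t0; move: C; apply: filtration_path => // s i s0.
rewrite (_ : (fun _ => _) = fun w => X (Num.min s t) w ord0 i).
  apply: (levy_adapted hF hX); first by rewrite le_min s0.
  by rewrite ge_min lexx orbT.
by apply/funext => w; rewrite (pval_stopp _ _ t0) (pval_Xpath hX).
Qed.

(* The path up to [t] sees the driving path only up to time [t - r]. *)
Lemma filtration_stopp_catp t r g C : 0 <= r -> r <= t -> measurable C ->
  F (t - r) ((fun w => stopp t (catp g r (Xpath X w)) : E) @^-1` C).
Proof.
move=> r0 rt; have t0 := le_trans r0 rt; have tr : 0 <= t - r by rewrite subr_ge0.
move: C; apply: filtration_path => // s i s0.
rewrite (_ : (fun _ => _) = fun w => pval g (Num.min s t) ord0 i +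
    X (Num.max (Num.min s t - r) 0) w ord0 i).
  apply: measurable_funD; first exact: measurable_cst.
  apply: (levy_adapted hF hX); first by rewrite le_max lexx orbT.
  by rewrite ge_max tr andbT lerD2r ge_min lexx orbT.
by apply/funext => w; rewrite (pval_stopp _ _ t0) pval_catp (pval_Xpath hX) mxE.
Qed.

Context (hf : fresh_increments T hF hX).

(* On [T <= t] both the path up to [t] and the increments after [t] are
   functions of the pre-[T] information and of the increments after [T];
   freeze the former and apply the Markov property at the then
   deterministic time [t - T]. *)
Lemma before_indep t C D : 0 <= t -> measurable C -> measurable D ->
  let A := [set w | (T w <= t%:E)%E] in
  P (A `&` (fun w => stopp t (Xpath X w) : E) @^-1` C `&`
      (fun w => deltap t (Xpath X w) : E) @^-1` D) =
  (P (A `&` (fun w => stopp t (Xpath X w) : E) @^-1` C) * L D)%E.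
Proof.
move=> t0 mC mD A.
have mTf := measurable_Tfin mT.
have ATf : A `<=` Tfin T by move=> w /= /le_lt_trans; apply; exact: ltry.
pose g w : E := stopp (fT T w) (Xpath X w).
(* The event written on pairs of a frozen sample point and a free path, the latter standing for
   [DeltaT]. The maximum only keeps the time nonnegative when T > t; on the event it equals t -
   T. *)
pose S (D' : set E) := [set z : OmegaT * E | [/\ Tfin T z.1, fT T z.1 <= t,
   C (stopp t (catp (g z.1) (fT T z.1) z.2)) &
   D' (deltap (Num.max (t - fT T z.1) 0) z.2)]].
have mfT : measurable_fun [set: OmegaT * E] (fun z => fT T z.1).
  by apply: measurableT_comp (measurable_fst) => //; exact: FTfull_fT.
have mS D' : measurable D' -> measurable (S D').
  move=> mD'.
  have -> : S D' = (fst @^-1` Tfin T) `&`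
      ((fun z : OmegaT * E => fT T z.1) @^-1` `]-oo, t]) `&`
      ((fun z : OmegaT * E => stopp t (catp (g z.1) (fT T z.1) z.2)) @^-1` C) `&`
      ((fun z : OmegaT * E => deltap (Num.max (t - fT T z.1) 0) z.2) @^-1` D').
    apply/seteqP; split => z /=; rewrite in_itv/=; first by move=> [].
    by move=> [[[]]].
  apply: measurableI; last first.
    rewrite -[X in measurable X]setTI; apply: measurable_deltap => //.
    - apply: measurable_maxr => //; apply: measurable_funB => //.
    - by move=> z; rewrite le_max lexx orbT.
  apply: measurableI; last first.
    rewrite -[X in measurable X]setTI.
    apply: (@measurable_stopp _ _ _ _ (fun=> t)) => //.
    apply: measurable_catp => //.
    by apply: measurableT_comp (measurable_fst) => //; exact: (FTfull_stopp hF mT T0 hX).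
  apply: measurableI; last first.
    by rewrite -[X in measurable X]setTI; apply: mfT => //; exact: measurable_itv.
  rewrite -[X in measurable X]setTI; apply: measurable_fst => //.
  rewrite measurable_g_measurableTypeE; last exact: FTfull_sigma.
  by split => //; rewrite setIid; exact: FT'_Tfin.
(* For frozen w with T <= t, the constraint by [C] sees f only up to t - T, so [levy_indep] at that
   time splits off D'; otherwise both sections are empty. *)
have inner D' w : measurable D' ->
    L [set f | S D' (w, f)] = (L [set f | S setT (w, f)] * L D')%E.
  move=> mD'.
  have [wA|wA] := pselect (Tfin T w /\ fT T w <= t); last first.
    have S0 D'' : [set f | S D'' (w, f)] = set0.
      by apply/seteqP; split => f // -[h1 h2 _ _]; apply: wA.
    by rewrite !S0 measure0 mul0e.
  have [Tw wt] := wA; have w0 := fT_ge0 T0 w.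
  have wt0 : 0 <= t - fT T w by rewrite subr_ge0.
  pose B := (fun w' => stopp t (catp (g w) (fT T w) (Xpath X w')) : E) @^-1` C.
  have FB : F (t - fT T w) B by exact: filtration_stopp_catp.
  have e D'' : L [set f | S D'' (w, f)] =
      P (B `&` (fun w' => deltap (t - fT T w) (Xpath X w')) @^-1` D'').
    rewrite /levy_law /image_measure /pushforward; congr (P _).
    apply/seteqP; split => w' /=; rewrite /S /= max_l//; first by move=> [].
    by move=> [].
  by rewrite !e (levy_indep hF hX wt0 FB mD') preimage_setT setIT.
have catE w : catp (g w) (fT T w) (DeltaT T X w) = Xpath X w.
  exact: (catp_stop _ (fT_ge0 T0 w)).
have delE w : fT T w <= t ->
    deltap (Num.max (t - fT T w) 0) (DeltaT T X w) = deltap t (Xpath X w).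
  move=> wt; have wt0 : 0 <= t - fT T w by rewrite subr_ge0.
  rewrite (max_l wt0); exact: (deltap_deltap _ (fT_ge0 T0 w) wt).
have joint D' : measurable D' ->
    P (A `&` (fun w => stopp t (Xpath X w) : E) @^-1` C `&`
        (fun w => deltap t (Xpath X w) : E) @^-1` D') =
    (\int[P]_(w in Tfin T) (L [set f | S setT (w, f)] * L D'))%E.
  move=> mD'; under eq_integral do rewrite -inner//.
  have idm : measurable_fun setT (id : Omega -> OmegaT) :=
    @FTfull_id _ _ _ F T.
  rewrite -(freezing_set mTf idm (measurable_DeltaT hF mT T0 hX) 
    (fresh_FTfull hf) (mS _ mD')).
  congr (P _); apply/seteqP; split => w.
    move=> [[Aw Cw] Dw]; have Tw := ATf _ Aw.
    have wt : fT T w <= t by rewrite -lee_fin -(TfinE T0 Tw).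
    split; first exact: Tw.
    rewrite /S /=; split; [exact: Tw|exact: wt| |].
      by rewrite catE; exact: Cw.
    by rewrite (delE _ wt); exact: Dw.
  move=> [_ [Tw /= wt Cw Dw]]; split; last by rewrite /= -(delE _ wt); exact: Dw.
  split; first by rewrite /A /= (TfinE T0 Tw) lee_fin.
  by rewrite /= -catE; exact: Cw.
have mphi : measurable_fun [set: Omega] (fun w : Omega => L [set f | S setT (w, f)]).
  exact: (measurableT_comp (measurable_section_measure L (mS _ (@measurableT _ E)))
    (@FTfull_id _ _ _ F T)).
have joint' D' : measurable D' ->
    P (A `&` (fun w => stopp t (Xpath X w) : E) @^-1` C `&`
        (fun w => deltap t (Xpath X w) : E) @^-1` D') =
    (\int[P]_(w in Tfin T) L [set f | S setT (w, f)] * L D')%E.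
  move=> mD'; apply: (etrans (joint D' mD')).
  exact: (@ge0_integralZr _ _ _ P _ mTf _ (measurable_funTS mphi) _
    (fun w _ => measure_ge0 _ _) (measure_ge0 _ _)).
have LT : L setT = 1%E by exact: probability_setT.
(* The choice D' = [setT] identifies the integral with the probability without the constraint on
   increments. *)
have := joint' _ (@measurableT _ E).
rewrite preimage_setT setIT (joint' _ mD) => ->.
by rewrite LT mule1.
Qed.

Lemma fresh_prop_iii :
  (forall B : set (\bar R), measurable B -> completion P (sigmaX X) (T @^-1` B)) ->
  prop_iii P F T.
Proof.
move=> hR t t0; set A := [set w | _].
have mA : measurable A.
  by have := emeasurable_fun_infty_c measurableT mT t%:E; rewrite setTI.
have cA : completion P (sigmaX X) A.
  have := hR _ (emeasurable_itv `]-oo, t%:E]); congr (completion _ _ _).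
have mX := measurable_Xpath hF hX.
have sX : sigmaX X `<=` measurable.
  move=> B /sigmaX_Xpath[C mC ->].
  by rewrite -[X in measurable X]setTI; exact: mX.
have [_ [A' /sigmaX_Xpath[C0 mC0 A'E] AA']] :=
  completion_ae (@smallest_sigma_algebra _ _ _) sX cA.
pose a w : E := stopp t (Xpath X w); pose b w : E := deltap t (Xpath X w).
have ma : measurable_fun setT a.
  by apply: (@measurable_stopp _ _ _ _ (fun=> t)) => //; exact: measurable_cst.
have mb : measurable_fun setT b by exact: (measurable_delta_Xpath hF hX t0).
(* [A'] as a condition on the pair (path up to t, increments after t), glued by [catp]. *)
pose S := [set z : E * E | C0 (catp z.1 t z.2)].
have mS : measurable S.
  rewrite -[X in measurable X]setTI.
  by apply: (@measurable_catp _ _ _ _ (fun=> t)) => //; exact: measurable_cst.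
have mSC : measurable (~` S) by exact: measurableC.
have Sab : [set w | S (a w, b w)] = A'.
  by rewrite A'E; apply/seteqP; split => w; rewrite /S /= /a /b catp_stop.
have indA C D : measurable C -> measurable D ->
    P (A `&` a @^-1` C `&` b @^-1` D) = (P (A `&` a @^-1` C) * L D)%E.
  exact: before_indep.
have indT C D : measurable C -> measurable D ->
    P (setT `&` a @^-1` C `&` b @^-1` D) = (P (setT `&` a @^-1` C) * L D)%E.
  by move=> mC mD; rewrite setTI (levy_indep hF hX t0 (filtration_stopp t0 mC) mD).
have mA' : measurable A'.
  by rewrite A'E -[X in measurable X]setTI; exact: mX.
pose p (g : E) := L [set y | S (g, y)].
(* The complementary probability 1 - p: that p = 1 almost surely on [A] is obtained from a vanishing
   nonnegative integral, and that integral is the one of q. *)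
pose q (g : E) := L [set y | (~` S) (g, y)].
have mpa : measurable_fun setT (p \o a) := measurableT_comp (measurable_section_measure L mS) ma.
have mqa : measurable_fun setT (q \o a) := measurableT_comp (measurable_section_measure L mSC) ma.
have pq g : q g = (1 - p g)%E.
  by rewrite /p /q -probability_setC//; exact: measurable_section.
(* Freezing on [A] turns the integral of q over [A] into the probability of [A] without [A'], which
   is 0 because the two agree almost surely. *)
have q0 : {ae P, forall w, A w -> q (a w) = 0%E}.
  have e : P (A `&` [set w | (~` S) (a w, b w)]) = (\int[P]_(w in A) q (a w))%E.
    exact: (freezing_set mA ma mb indA mSC).
  have e0 : P (A `&` [set w | (~` S) (a w, b w)]) = 0%E.
    rewrite -(measure0 P); apply: ae_iff_measure => //.
      apply: measurableI => //; rewrite (_ : mkset _ = ~` A'); last by rewrite -Sab.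
      exact: measurableC.
    apply: filterS AA' => w h; split => // -[/h Aw].
    by rewrite -Sab in Aw; move=> /(_ Aw).
  apply/(ae_eq_integral_abs P mA (measurable_funTS mqa)).
  by rewrite -[RHS]e0 e; apply: eq_integral => w _; rewrite /= gee0_abs.
(* The integrals of p over [A] and over the whole space are the probabilities of the intersection of
   [A] with [A'] and of [A']. They coincide and are finite, so nothing is left for the complement of
   [A]. *)
have p0 : {ae P, forall w, (~` A) w -> p (a w) = 0%E}.
  apply/(ae_eq_integral_abs P (measurableC mA) (measurable_funTS mpa)).
  under eq_integral do rewrite gee0_abs//.
  have e1 : P (A `&` A') = (\int[P]_(w in A) p (a w))%E.
    by rewrite -Sab; exact: (freezing_set mA ma mb indA mS).
  have e2 : P A' = (\int[P]_w p (a w))%E.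
    by rewrite -Sab -[X in P X]setTI; exact: (freezing_set measurableT ma mb indT mS).
  have e3 : P (A `&` A') = P A'.
    apply: ae_iff_measure => //; first exact: measurableI.
    by apply: filterS AA' => w h; split => [[]//|Aw]; split => //; exact/h.
  move: e2; rewrite -(setUv A) ge0_integral_setU//=; last 3 first.
  - exact: measurableC.
  - by rewrite setUv.
  - by apply/disj_setPLR; rewrite setCK.
  rewrite -e1 e3 => e; have fA : P A' \is a fin_num by exact: fin_num_measure.
  by rewrite -[LHS](addeK _ fA) [X in (X - _)%E]addeC -e subee.
(* [B] depends only on the path up to t, so it lies in F_t before completion. *)
pose B := [set w | q (a w) = 0%E].
apply: (@completion_of_ae _ _ _ _ _ _ B) => //.
  suff : F t (a @^-1` [set g | q g = 0%E]) by exact.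
  apply: (filtration_stopp t0).
  by rewrite -[X in measurable X]setTI; exact: (measurable_section_measure L mSC measurableT (emeasurable_set1 0%E)).
apply: filterS2 q0 p0 => w hq hp; split => //.
move=> qw; apply: contrapT => /hp pw; move: qw; rewrite /B /= pq pw sube0.
by move=> /eqP; rewrite onee_eq0.
Qed.

End Converse.

Unset Implicit Arguments.

Theorem theorem3p20 (R : realType) (d : measure_display)
  (Omega : measurableType d) (P : probability Omega R) (n : nat)
  (F : R -> set (set Omega)) (X : R -> Omega -> 'rV[R]_n)
  (T : Omega -> \bar R) :
  filtration F -> levy P F X ->
  measurable_fun setT T -> (forall w, (0 <= T w)%E) ->
  (0 < P (Tfin T))%E ->
  (prop_iii P F T -> prop_ii P F X T) /\
  (prop_i P F X T <-> prop_ii P F X T) /\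
  ((forall B : set (\bar R), measurable B ->
      completion P (sigmaX X) (T @^-1` B)) ->
   prop_ii P F X T -> prop_iii P F T).
Proof.
move=> hF hX mT T0 Tp; have iiP := prop_iiP hF mT T0 hX Tp.
split; first by move=> sT; apply/iiP; exact: (strong_markov hF mT T0 hX sT).
split.
  split; first by move=> hi; apply/iiP; exact: (prop_i_fresh hF mT T0 hX Tp hi).
  by move=> /iiP; exact: fresh_prop_i.
by move=> hR /iiP hf; exact: (fresh_prop_iii mT T0 hf hR).
Qed.
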